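(* Let $\mathcal R=(\mathbb R,+,\cdot,0,1,<,\dots)$ be an o-minimal expansion of the ordered real field in a language $\mathcal L$. Let $m,d$ be positive integers, let $\phi(y,\bar x;\bar z)$ be an $\mathcal L$-formula with $y$ a single variable, $\bar x$ an $m$-tuple of variables and $\bar z$ a $d$-tuple of variables, and let $\mathcal F=\{f_{\bar b}\}_{\bar b\in\mathbb R^d}$ be a family of functions $f_{\bar b}:\mathbb R^m\to\mathbb R$ such that for all $\bar b\in\mathbb R^d$, $\bar x\in\mathbb R^m$ and $y\in\mathbb R$, $f_{\bar b}(\bar x)=y$ if and only if $\mathcal R\models\phi(y,\bar x;\bar b)$. Then the VC-density of the class of sets $\{\mathrm{subgraph}(f):f\in\mathcal F\}$ is at most $d$.
   Context: Language and o-minimality: $\mathcal L$ is a first-order language containing the language of ordered rings $\{+,\cdot,0,1,<\}$, and $\mathcal R$ is an $\mathcal L$-structure with universe $\mathbb R$ in which these symbols have their standard interpretation. $\mathcal R$ is o-minimal if every subset of $\mathbb R$ definable in $\mathcal R$ by an $\mathcal L$-formula (with real parameters allowed) is a finite union of open intervals (possibly unbounded) and points. Subgraph: for $f:\mathbb R^m\to\mathbb R$, $\mathrm{subgraph}(f)=\{(x,t)\in\mathbb R^{m+1}: 0\le t\le f(x)\text{ or }0>t>f(x)\}$. VC-density: for a collection $\mathcal A$ of subsets of a set $X$ and a finite $G\subset X$, let $G\cap\mathcal A=\{G\cap A:A\in\mathcal A\}$ and $\Delta_{\mathcal A}(n)=\sup_{|G|=n}|G\cap\mathcal A|$. The VC-density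 of $\mathcal A$ is the infimum of the set of positive reals $r$ for which there is a constant $C>0$ (possibly depending on $r$) with $\Delta_{\mathcal A}(n)\le Cn^r$ for all positive integers $n$. *)

(* Defs.v *)
From HB Require Import structures.
From mathcomp Require Import all_boot all_order all_algebra.
From mathcomp Require Import finmap.
From mathcomp Require Import all_classical all_reals all_analysis.

Set Implicit Arguments.
Unset Strict Implicit.
Unset Printing Implicit Defensive.

Import Order.TTheory GRing.Theory Num.Theory.

Local Open Scope classical_set_scope.
Local Open Scope ring_scope.

(* Symbols are indexed by their arity; constants are nullary functions. *)
Record language := Language {
  fun_symb : nat -> Type;
  rel_symb : nat -> Type }.

Record ring_language := RingLanguage {
  ring_lang :> language;
  add_symb  : fun_symb ring_lang 2;
  mul_symb  : fun_symb ring_lang 2;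
  zero_symb : fun_symb ring_lang 0;
  one_symb  : fun_symb ring_lang 0;
  lt_symb   : rel_symb ring_lang 2 }.

(* [term L n] and [formula L n] have their free variables among ['I_n].
   Binders are de Bruijn style: below a quantifier, variable 0 is the bound one
   and variable i.+1 is the former variable i. *)
Inductive term (L : language) (n : nat) : Type :=
| Var of 'I_n
| App k of fun_symb L k & ('I_k -> term L n).

Inductive formula (L : language) : nat -> Type :=
| Equal n of term L n & term L n : formula L n
| Rel n k of rel_symb L k & ('I_k -> term L n) : formula L n
| Not n of formula L n : formula L n
| And n of formula L n & formula L n : formula L n
| Or n of formula L n & formula L n : formula L n
| Imp n of formula L n & formula L n : formula L n
| Forall n of formula L n.+1 : formula L n
| Exists n of formula L n.+1 : formula L n.

Record structure (L : language) (U : Type) := Structure {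
  fun_interp : forall k, fun_symb L k -> 'rV[U]_k -> U;
  rel_interp : forall k, rel_symb L k -> 'rV[U]_k -> Prop }.

Section Semantics.
Variables (L : language) (U : Type) (M : structure L U).

Fixpoint eval n (e : 'rV[U]_n) (t : term L n) : U :=
  match t with
  | Var i => e ord0 i
  | App _ g ts => fun_interp M g (\row_i eval e (ts i))
  end.

Fixpoint sat n (phi : formula L n) : 'rV[U]_n -> Prop :=
  match phi in formula _ n return 'rV[U]_n -> Prop with
  | Equal _ s t => fun e => eval e s = eval e t
  | Rel _ _ r ts => fun e => rel_interp M r (\row_i eval e (ts i))
  | Not _ p => fun e => ~ sat p e
  | And _ p q => fun e => sat p e /\ sat q e
  | Or _ p q => fun e => sat p e \/ sat q e
  | Imp _ p q => fun e => sat p e -> sat q e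
  | Forall _ p => fun e => forall u, sat p (row_mx (const_mx u : 'rV_1) e)
  | Exists _ p => fun e => exists u, sat p (row_mx (const_mx u : 'rV_1) e)
  end.

End Semantics.

Section OMinimality.
Variable R : realType.

Definition expands_real_field (L : ring_language) (M : structure L R) : Prop :=
  [/\ forall v, fun_interp M (add_symb L) v = v ord0 ord0 + v ord0 ord_max,
      forall v, fun_interp M (mul_symb L) v = v ord0 ord0 * v ord0 ord_max,
      forall v, fun_interp M (zero_symb L) v = 0,
      forall v, fun_interp M (one_symb L) v = 1
    & forall v, rel_interp M (lt_symb L) v <-> v ord0 ord0 < v ord0 ord_max].

Definition definable (L : language) (M : structure L R) (A : set R) : Prop :=
  exists (p : nat) (phi : formula L (1 + p)) (c : 'rV[R]_p),
    A = [set y | sat M phi (row_mx (const_mx y) c)].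

(* Infinite endpoints give the unbounded open intervals. *)
Definition open_interval_or_point (S : set R) : Prop :=
  (exists a b : \bar R, S = [set x | (a < x%:E < b)%E]) \/
  (exists a : R, S = [set a]).

Definition o_minimal (L : language) (M : structure L R) : Prop :=
  forall A : set R, definable M A ->
    exists (k : nat) (S : 'I_k -> set R),
      (forall i, open_interval_or_point (S i)) /\ A = \bigcup_i S i.

Definition subgraph (m : nat) (f : 'rV[R]_m -> R) : set 'rV[R]_(m + 1) :=
  [set v : 'rV[R]_(m + 1) |
    let x := lsubmx v in let t := rsubmx v ord0 ord0 in
    0 <= t <= f x \/ f x < t < 0].

End OMinimality.

Section VCDensity.
Variables (R : realType) (X : choiceType).

Definition trace (G : {fset X}) (A : set (set X)) : set (set X) :=
  [set [set` G] `&` B | B in A].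

(* Hence [fset_set (trace G A)] below has exactly the elements of the trace
   ([fset_set] is empty on infinite sets). *)
Lemma finite_trace (G : {fset X}) (A : set (set X)) : finite_set (trace G A).
Proof.
apply: (@sub_finite_set _ _ [set [set` H] | H in [set` fpowerset G]]).
  move=> _ [B _ <-]; exists [fset x in G | x \in B]%fset.
    by rewrite /= fpowersetE; apply/fsubsetP => x; rewrite !inE => /andP[].
  apply/seteqP; split=> x /=; rewrite !inE /=.
    by move=> /andP[xG /set_mem].
  by move=> [xG xB]; apply/andP; split=> //; exact/mem_set.
exact/finite_image/finite_fset.
Qed.

Definition shatter (A : set (set X)) (n : nat) : \bar R :=
  ereal_sup [set (#|` fset_set (trace G A)|%:R)%:E | G in
              [set G : {fset X} | #|` G| = n]].

(* Extended-real infimum: the density is [+oo] when no exponent works. *)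
Definition vc_density (A : set (set X)) : \bar R :=
  ereal_inf [set r%:E | r in [set r : R | 0 < r /\
    exists C : R, 0 < C /\ forall n : nat, (0 < n)%N ->
      (shatter A n <= (C * n%:R `^ r)%:E)%E]].

End VCDensity.

Arguments shatter R {X} A n.
Arguments vc_density R {X} A.

(* Main.v *)
Require Import Defs.
From HB Require Import structures.
From mathcomp Require Import all_boot all_order all_algebra.
From mathcomp Require Import finmap.
From mathcomp Require Import all_classical all_reals all_analysis.
From mathcomp Require Import zify lra.

Set Implicit Arguments.
Unset Strict Implicit.
Unset Printing Implicit Defensive.

Import Order.TTheory GRing.Theory Num.Theory.

Local Open Scope classical_set_scope.

(** The heart of the proof is a count of traces by induction on d (card_traces).
   Consider n objects a_1, ..., a_n and a definable predicate P in the parameters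
   t, g and an object, where t is a single parameter and g stands for d others.
   For fixed g, the sets S_k = {t | P (t, g, a_k)} cut the line at their boundary
   points, and the trace of (t, g), the set of all k with t in S_k, depends only on
   the last cut before t. If each S_k has fewer than N alternations between
   membership and non-membership, that cut is the i-th alternation of S_j for one
   of N * n pairs (i, j), where i = 0 stands for no cut at all, and to lie in S_k
   just after it is a definable condition on g and the pair of objects (a_k, a_j).
   So n ^ d traces, up to a constant, become n ^ (d + 1). For subgraphs, the objects
   are the points of the graph space, the parameters are the d coordinates of b,
   and P expresses membership in the subgraph of f_b; so n points have at most
   C n ^ d traces, and the density is at most d.

   The constant needs a bound N that holds for all g and all objects
   (uniform_finiteness), while o-minimality bounds the alternations of each set
   separately. For a family with a single parameter x this is the theorem
   finiteness: with definable choice and a definable notion of closeness, the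
   finite fibres near all but finitely many x correspond to each other
   bijectively, so that the number of their points is constant between finitely
   many exceptional x.

   Further parameters are added one at a time, by induction over all structures
   at once. If there were no bound, some ultrafilter would contain, for every k, the
   set of values of one parameter x for which k boundary points occur. Pass to the
   ultrapower formed with definable functions of x only (ultrapower). It is again
   o-minimal, exactly because of the theorem for a single parameter (ultra_tame),
   and x has become one of its points. So the number of parameters has dropped,
   and the induction hypothesis for the ultrapower gives a bound that holds for
   almost all x, a contradiction.

   The ultrapower is in general not the real line. Therefore these arguments are
   carried out for abstract ordered structures (tame) in which definable sets have
   finitely many boundary points and suprema, and definable choice holds. *)

(** * Definable structures *)

Lemma eq_iff (P Q : Prop) : P = Q -> (P <-> Q).
Proof. by move->. Qed.

(** Environments are infinite sequences, so that they need no dimension; a pushed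
   value becomes variable 0, as the bound variable does in formulas. *)
Definition push (T : Type) (y : T) (e : nat -> T) : nat -> T :=
  fun i => if i is j.+1 then e j else y.

(** An ordered structure, reduced to what survives in definable ultrapowers and is
   used in the proof. The field operations are replaced by the definable
   uniformity that they provide: over the reals, [proximal d x y] stands for
   |x - y| < d and [scale d] for d > 0. *)
Record system := System {
  elt :> Type;
  lt : elt -> elt -> Prop;
  scale : elt -> Prop;
  proximal : elt -> elt -> elt -> Prop;
  Def : ((nat -> elt) -> Prop) -> Prop }.

Arguments lt {_}.
Arguments scale {_}.
Arguments proximal {_}.
Arguments Def {_}.

Record definability (K : system) : Prop := {
  Def_and : forall P Q : (nat -> K) -> Prop,
    Def P -> Def Q -> Def (fun e => P e /\ Q e);
  Def_not : forall P : (nat -> K) -> Prop, Def P -> Def (fun e => ~ P e);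
  Def_ex : forall P : (nat -> K) -> Prop,
    Def P -> Def (fun e => exists y, P (push y e));
  Def_ren : forall (P : (nat -> K) -> Prop) (s : nat -> nat),
    Def P -> Def (fun e => P (fun i => e (s i)));
  Def_lt01 : Def (fun e : nat -> K => lt (e 0) (e 1));
  Def_scale0 : Def (fun e : nat -> K => scale (e 0));
  Def_proximal012 : Def (fun e : nat -> K => proximal (e 0) (e 1) (e 2));
  Def_const0 : forall c : K, Def (fun e => e 0 = c);
  Def_supp : forall P : (nat -> K) -> Prop, Def P ->
    exists n, forall e e', (forall i, i < n -> e i = e' i) -> P e -> P e' }.

Record uniform_order (K : system) : Prop := {
  lt_irr : forall x : K, ~ lt x x;
  lt_tr : forall x y z : K, lt x y -> lt y z -> lt x z;
  lt_tricho : forall x y : K, lt x y \/ x = y \/ lt y x;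
  lt_dense : forall x y : K, lt x y -> exists z, lt x z /\ lt z y;
  lt_left : forall x : K, exists y, lt y x;
  lt_right : forall x : K, exists y, lt x y;
  scale_ex : exists d : K, scale d;
  proximal_refl : forall d x : K, scale d -> proximal d x x;
  proximal_sym : forall d x y : K, proximal d x y -> proximal d y x;
  proximal_mono : forall d d' x y : K, lt d d' -> proximal d x y -> proximal d' x y;
  proximal_half : forall d : K, scale d -> exists d', scale d' /\
    forall x y z, proximal d' x y -> proximal d' z y -> proximal d x z;
  proximal_ball : forall a x b : K, lt a x -> lt x b -> exists d, scale d /\
    forall y, proximal d x y -> lt a y /\ lt y b;
  proximal_small : forall a b d : K, lt a b -> scale d ->
    exists a' b', lt a a' /\ lt a' b' /\ lt b' b /\
    forall x y, lt a' x -> lt x b' -> lt a' y -> lt y b' -> proximal d x y }.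

Fixpoint at_least (T : Type) (k : nat) (S : T -> Prop) : Prop :=
  if k is j.+1 then exists y, S y /\ at_least j (fun z => S z /\ z <> y) else True.

Definition fin (T : Type) (S : T -> Prop) := exists k, ~ at_least k S.

Definition boundary (K : system) (S : K -> Prop) (c : K) : Prop :=
  forall a b : K, lt a c -> lt c b ->
    exists y, (lt a y /\ lt y b) /\ exists z, (lt a z /\ lt z b) /\ (S y /\ ~ S z).

(** Over the reals, both properties follow from the decomposition of definable sets
   into intervals and points. They are the form of o-minimality that transfers
   to ultrapowers: for one definable family, a bound on the number of boundary
   points and the existence of suprema are first-order statements. *)
Record o_minimal_system (K : system) : Prop := {
  fin_bd : forall (P : (nat -> K) -> Prop) e,
    Def P -> fin (boundary (fun y => P (push y e)));
  def_sup : forall (P : (nat -> K) -> Prop) e, Def P ->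
    (exists y, P (push y e)) ->
    (exists b, forall y, P (push y e) -> ~ lt b y) ->
    exists c, (forall y, P (push y e) -> ~ lt c y) /\
      forall b, (forall y, P (push y e) -> ~ lt b y) -> ~ lt b c }.

(** Definable choice: Q is the graph of a function that selects a point in each
   nonempty fibre of P. *)
Definition uniformizable (K : system) : Prop :=
  forall P : (nat -> K) -> Prop, Def P -> exists Q : (nat -> K) -> Prop,
    [/\ Def Q, forall e, Q e -> P e,
        forall e y, P (push y e) -> exists z, Q (push z e)
      & forall e y z, Q (push y e) -> Q (push z e) -> y = z].

Record o_minimal_structure (K : system) : Prop := {
  tame_def : definability K;
  tame_order : uniform_order K;
  tame_omin : o_minimal_system K }.

Record tame (K : system) : Prop := {
  tame_om :> o_minimal_structure K;
  tame_choice : uniformizable K }.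

(** * Closure properties *)

Section Closure.
Variables (K : system) (HK : definability K).
Implicit Types (P Q : (nat -> K) -> Prop) (e : nat -> K).

Definition Def1 (A : K -> Prop) := Def (fun e => A (e 0)).
Definition Def2 (A : K -> K -> Prop) := Def (fun e => A (e 0) (e 1)).
Definition Def3 (A : K -> K -> K -> Prop) := Def (fun e => A (e 0) (e 1) (e 2)).

Lemma Def_iff P Q : (forall e, P e <-> Q e) -> Def P -> Def Q.
Proof. by move=> PQ; have -> : P = Q by apply: funext => e; exact/propext. Qed.

Lemma Def_or P Q : Def P -> Def Q -> Def (fun e => P e \/ Q e).
Proof.
move=> DP DQ; apply: (@Def_iff (fun e => ~ (~ P e /\ ~ Q e))).
  by move=> e; rewrite not_andP !notK.
by apply: Def_not => //; apply: Def_and => //; exact: Def_not.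
Qed.

Lemma Def_imp P Q : Def P -> Def Q -> Def (fun e => P e -> Q e).
Proof.
move=> DP DQ; apply: (@Def_iff (fun e => ~ P e \/ Q e)).
  by move=> e; rewrite implyE.
by apply: Def_or => //; exact: Def_not.
Qed.

Lemma Def_iffP P Q : Def P -> Def Q -> Def (fun e => P e <-> Q e).
Proof. by move=> DP DQ; apply: Def_and => //; exact: Def_imp. Qed.

Lemma Def_exists (Q : (nat -> K) -> K -> Prop) :
  Def (fun e => Q (fun i => e i.+1) (e 0)) -> Def (fun e => exists y, Q e y).
Proof. by move/(Def_ex HK). Qed.

Lemma Def_forall (Q : (nat -> K) -> K -> Prop) :
  Def (fun e => Q (fun i => e i.+1) (e 0)) -> Def (fun e => forall y, Q e y).
Proof.
move=> DQ; apply: (@Def_iff (fun e => ~ exists y, ~ Q e y)).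
  by move=> e; split=> [H y|H [y]]; [apply: contrapT => NQ; apply: H; exists y | apply].
by apply: Def_not => //; apply: Def_exists; exact: Def_not.
Qed.

Lemma Def1_at A i : Def1 A -> Def (fun e => A (e i)).
Proof. by move=> DA; apply: (Def_ren HK (fun=> i) DA). Qed.

Lemma Def2_at A i j : Def2 A -> Def (fun e => A (e i) (e j)).
Proof. by move=> DA; apply: (Def_ren HK (fun k => if k is 0 then i else j) DA). Qed.

Lemma Def3_at A i j k : Def3 A -> Def (fun e => A (e i) (e j) (e k)).
Proof.
move=> DA.
by apply: (Def_ren HK (fun l => if l is l'.+1 then if l' is 0 then j else k else i) DA).
Qed.

Lemma Def_lt i j : Def (fun e => lt (e i) (e j)).
Proof. exact: (@Def2_at lt i j (Def_lt01 HK)). Qed.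

Lemma Def_scale i : Def (fun e => scale (e i)).
Proof. exact: (@Def1_at scale i (Def_scale0 HK)). Qed.

Lemma Def_proximal i j k : Def (fun e => proximal (e i) (e j) (e k)).
Proof. exact: (@Def3_at proximal i j k (Def_proximal012 HK)). Qed.

Lemma Def_param (F : K -> (nat -> K) -> Prop) c :
  Def (fun e => F (e 0) (fun i => e i.+1)) -> Def (F c).
Proof.
move=> DF; apply: (@Def_iff (fun e => exists y, y = c /\ F y e)).
  by move=> e; split=> [[y [-> //]]|Fc]; exists c.
apply: (@Def_exists (fun e y => y = c /\ F y e)).
by apply: Def_and => //; exact: Def_const0.
Qed.

Lemma Def_false : Def (fun e : nat -> K => False).
Proof.
have [H|H] := pselect (exists c : K, True).
  case: H => c _; apply: (@Def_param (fun c e => False) c).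
  apply: (@Def_iff (fun e => e 0 = c /\ ~ e 0 = c)); first by move=> e; split=> // -[].
  by apply: Def_and => //; [|apply: Def_not => //]; exact: Def_const0.
apply: (@Def_iff (fun e => lt (e 0) (e 1))); last exact: Def_lt.
by move=> e; exfalso; apply: H; exists (e 0).
Qed.

Lemma Def_true : Def (fun e : nat -> K => True).
Proof.
apply: (@Def_iff (fun e => ~ False)); first by move=> e; tauto.
by apply: Def_not => //; exact: Def_false.
Qed.

Lemma Def_push P a s : Def P -> Def (fun e => P (push (e a) (fun i => e (s i)))).
Proof.
move=> DP; apply: Def_iff (Def_ren HK (fun i => if i is j.+1 then s j else a) DP) => e.
by apply: eq_iff; congr P; apply: funext => -[].
Qed.

Hypothesis KO : uniform_order K.

Lemma Def_eq i j : Def (fun e => e i = e j).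
Proof.
apply: (@Def_iff (fun e => ~ lt (e i) (e j) /\ ~ lt (e j) (e i))).
  move=> e; split=> [[nij nji]|->]; last by split; exact: lt_irr.
  by have [|[]] := lt_tricho KO (e i) (e j).
by apply: Def_and => //; apply: Def_not => //; exact: Def_lt.
Qed.

Lemma Def_at_least k (Q : (nat -> K) -> K -> Prop) :
  Def (fun e => Q (fun i => e i.+1) (e 0)) -> Def (fun e => at_least k (Q e)).
Proof.
elim: k Q => [|k IH] Q DQ /=; first exact: Def_true.
apply: Def_exists; apply: Def_and => //.
apply: (IH (fun e z => Q (fun i => e i.+1) z /\ z <> e 0)).
apply: Def_and => //; last by apply: Def_not => //; exact: Def_eq.
by apply: (Def_ren HK (fun i => if i is j.+1 then j.+2 else 0) DQ).
Qed.

Lemma Def_bd (Q : (nat -> K) -> K -> Prop) j :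
  Def (fun e => Q (fun i => e i.+1) (e 0)) -> Def (fun e => boundary (Q e) (e j)).
Proof.
move=> DQ; rewrite /boundary.
do 2 apply: Def_forall; do 2 (apply: Def_imp; first exact: Def_lt).
apply: Def_exists; apply: Def_and => //.
  by apply: Def_and => //; exact: Def_lt.
apply: Def_exists; apply: Def_and => //.
  by apply: Def_and => //; exact: Def_lt.
apply: Def_and => //.
  by apply: (Def_ren HK (fun i => if i is j.+1 then j.+4 else 1) DQ).
apply: Def_not => //.
by apply: (Def_ren HK (fun i => if i is j.+1 then j.+4 else 0) DQ).
Qed.

(** Definable functions may be substituted for the variables. The predicate
   has finite support, so only finitely many graphs are needed; the first n
   coordinates of the environment hold the values until all are replaced. *)
Lemma Def_subst (P : (nat -> K) -> Prop) (t : nat -> (nat -> K) -> K) :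
  Def P -> (forall i, Def (fun e => e 0 = t i (fun j => e j.+1))) ->
  Def (fun e => P (fun i => t i e)).
Proof.
move=> DP Dt; have [n Pn] := Def_supp HK DP.
pose Q k e := P (fun i => if i < k then t i (fun j => e (n + j)) else e i).
have DQ k : k <= n -> Def (Q k).
  elim: k => [_|k IH kn]; first exact: DP.
  apply: (@Def_iff (fun e => exists y, y = t k (fun j => e (n + j)) /\
     Q k (fun i => if i == k then y else e i))).
    move=> e; have E y : y = t k (fun j => e (n + j)) ->
      Q k (fun i => if i == k then y else e i) = Q k.+1 e.
      move=> ->; congr P; apply: funext => i; rewrite [i < k.+1]ltnS [i <= k]leq_eqVlt.
      have [-> /=|ik /=] := eqVneq i k; first by rewrite ltnn.
      case: ifP => // _; congr (t i _); apply: funext => j.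
      by rewrite gtn_eqF // (leq_trans kn) // leq_addr.
    split=> [[y [yE]]|QS]; first by rewrite E.
    by exists (t k (fun j => e (n + j))); rewrite E.
  apply: Def_exists; apply: Def_and => //.
    apply: (Def_ren HK (fun i => if i is j.+1 then (n + j).+1 else 0) (Dt k)).
  apply: (Def_iff _ (Def_ren HK (fun i => if i == k then 0 else i.+1) (IH (ltnW kn)))).
  move=> e; rewrite -[X in X <-> _]/(Q k _); apply: eq_iff; congr Q.
  by apply: funext => i; case: ifP.
apply: (Def_iff _ (Def_ren HK (fun i => i - n) (DQ n (leqnn n)))) => e.
have E i : i < n -> (if i < n then t i (fun j => e (n + j - n)) else e (i - n)) = t i e.
  by move=> ->; congr (t i _); apply: funext => j; rewrite addKn.
by split; apply: Pn => i /E.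
Qed.

Lemma Def_push_env P e0 : Def P -> Def1 (fun y => P (push y e0)).
Proof.
move=> DP; apply: (@Def_subst P (fun i e => if i is j.+1 then e0 j else e 0)) => //.
case=> [|i]; first exact: Def_eq.
exact: Def_const0.
Qed.

Lemma Def_push2_env P e0 : Def P -> Def2 (fun y x => P (push y (push x e0))).
Proof.
move=> DP.
apply: (Def_iff _ (@Def_subst P (fun i e => if i is j.+1 then if j is k.+1 then e0 k else e 1 else e 0) DP _)).
  by move=> e; apply: eq_iff; congr P; apply: funext => -[|[]].
by case=> [|[|i]]; [exact: Def_eq|exact: Def_eq|exact: Def_const0].
Qed.

End Closure.

Ltac def_param :=
  match goal with
  | c : elt ?K |- Def ?P =>
    match P with context [c] =>
      let P' := eval pattern c in P in
      match P' with ?F _ => apply: (@Def_param K _ F c) => //; cbv beta end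
    end
  end.

Ltac def_step :=
  first
  [ assumption
  | lazymatch goal with
    | |- Def (fun e => (_ /\ _)) => apply: Def_and => //
    | |- Def (fun e => (_ \/ _)) => apply: Def_or => //
    | |- Def (fun e => ~ _) => apply: Def_not => //
    | |- Def (fun e => (_ <-> _)) => apply: Def_iffP => //
    | |- Def (fun e => (exists y, _)) => apply: Def_exists => //
    | |- Def (fun e => (forall y, _)) =>
        first [apply: Def_imp => // | apply: Def_forall => //]
    | |- Def (fun e => lt _ _) => apply: Def_lt => //
    | |- Def (fun e => scale _) => apply: Def_scale => //
    | |- Def (fun e => proximal _ _ _) => apply: Def_proximal => //
    | |- Def (fun e => _ = _) => apply: Def_eq => //
    | |- Def (fun e => at_least _ _) => apply: Def_at_least => //
    | |- Def (fun e => boundary _ _) => apply: Def_bd => //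
    | |- Def (fun e => True) => apply: Def_true => //
    end
  | match goal with
    | H : Def1 ?A |- _ => apply: (Def1_at _ _ H) => //
    | H : Def2 ?A |- _ => apply: (Def2_at _ _ _ H) => //
    | H : Def3 ?A |- _ => apply: (Def3_at _ _ _ _ H) => //
    | H : Def ?P |- Def (fun e => ?P (push _ _)) => apply: (Def_push _ _ _ H) => //
    end ].

(* The parameters in the predicate are first turned into variables; after that,
   its syntax directs the proof. *)
Ltac def_tac :=
  try unfold Def1, Def2, Def3; cbv beta; repeat def_param; repeat (def_step; cbv beta).

(** * Finite sets *)

Lemma at_least_sub (T : Type) k (S S' : T -> Prop) :
  (forall y, S y -> S' y) -> at_least k S -> at_least k S'.
Proof.
elim: k S S' => // k IH S S' SS' [y [/SS' S'y Sk]]; exists y; split=> //.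
by apply: IH Sk => z [/SS']; split.
Qed.

Lemma at_least_pred (T : Type) k (S : T -> Prop) : at_least k.+1 S -> at_least k S.
Proof.
elim: k S => // k IH S [y [Sy Sk]]; exists y; split=> //; exact: IH.
Qed.

Lemma at_least_leq (T : Type) j k (S : T -> Prop) : j <= k -> at_least k S -> at_least j S.
Proof.
move=> /subnK <-; elim: (k - j) => // n IH; rewrite addSn => /at_least_pred; exact: IH.
Qed.

Lemma at_least_inj (T U : Type) k (S : T -> Prop) (S' : U -> Prop) (f : T -> U) :
  (forall y, S y -> S' (f y)) -> (forall y z, S y -> S z -> f y = f z -> y = z) ->
  at_least k S -> at_least k S'.
Proof.
elim: k S S' => // k IH S S' fS finj [y [Sy Sk]]; exists (f y); split; first exact: fS.
apply: IH Sk => [z [Sz zy]|z w [Sz _] [Sw _]]; last exact: finj.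
by split; [exact: fS | move=> /finj -/(_ Sz Sy)].
Qed.

Lemma fin_sub (T : Type) (S S' : T -> Prop) :
  (forall y, S y -> S' y) -> fin S' -> fin S.
Proof. by move=> SS' [k S'k]; exists k => /(at_least_sub SS'). Qed.

Section OneVariable.
Variables (K : system) (HK : o_minimal_structure K).

Let KD := tame_def HK.
Let KO := tame_order HK.

Lemma fin_min (F : K -> Prop) : fin F -> (exists y, F y) ->
  exists c, F c /\ forall y, F y -> ~ lt y c.
Proof.
case=> k; elim: k F => [F []//|k IH F Fk [x Fx]].
have [[y Fy]|F0] := pselect (exists y, F y /\ y <> x); last first.
  exists x; split=> // y Fy yx; apply: F0; exists y; split=> // yE.
  by apply: (lt_irr KO (x := x)); rewrite -{1}yE.
have [||c [[Fc cx] cmin]] := IH (fun y => F y /\ y <> x).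
- by move=> Fk'; apply: Fk; exists x.
- by exists y.
have [cltx|[//|xltc]] := lt_tricho KO c x.
  exists c; split=> // z Fz zc; have [zx|zx] := pselect (z = x).
    by subst z; exact: lt_irr (lt_tr KO zc cltx).
  exact: (cmin z).
exists x; split=> // z Fz zx; have [zE|zE] := pselect (z = x).
  by subst z; exact: lt_irr zx.
by apply: (cmin z) => //; exact: lt_tr zx xltc.
Qed.

Lemma scale_min (d d' : K) : scale d -> scale d' ->
  exists m, [/\ scale m, m = d \/ lt m d & m = d' \/ lt m d'].
Proof.
move=> sd sd'; have [dd'|[->|d'd]] := lt_tricho KO d d'.
- by exists d; split=> //; [left | right].
- by exists d'; split=> //; left.
- by exists d'; split=> //; [right | left].
Qed.

Definition shrinking (Q : K -> K -> Prop) :=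
  forall y d d', lt d' d -> Q y d -> Q y d'.

Lemma fin_scale (F : K -> Prop) (Q : K -> K -> Prop) : fin F -> shrinking Q ->
  (forall y, F y -> exists d, scale d /\ Q y d) ->
  exists d, scale d /\ forall y, F y -> Q y d.
Proof.
move=> + Qm; case=> k; elim: k F => [F []//|k IH F Fk FQ].
have [[x Fx]|F0] := pselect (exists y, F y); last first.
  by have [d sd] := scale_ex KO; exists d; split=> // y Fy; case: F0; exists y.
have [||d [sd dQ]] := IH (fun y => F y /\ y <> x).
- by move=> Fk'; apply: Fk; exists x.
- by move=> y [/FQ].
have [d' [sd' d'Q]] := FQ x Fx; have [m [sm md md']] := scale_min sd sd'.
exists m; split=> // y Fy; have [->|yx] := pselect (y = x).
  by case: md' => [->//|md']; exact: Qm md' d'Q.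
case: md => [->|md]; first exact: dQ.
by apply: Qm md _; exact: dQ.
Qed.

Lemma at_least_interval (a b : K) k : lt a b -> at_least k (fun y => lt a y /\ lt y b).
Proof.
elim: k b => // k IH b ab; have [c [ac cb]] := lt_dense KO ab.
exists c; split=> //; apply: at_least_sub (IH c ac) => y [ay yc].
by split; [split=> //; exact: lt_tr yc cb | move=> yE; subst y; exact: lt_irr yc].
Qed.

(** * Definable sets of points *)

Lemma fin_bd1 S : @Def1 K S -> fin (boundary S).
Proof.
have [c _] := scale_ex KO => DS.
exact: (fin_bd (tame_omin HK) (fun=> c) DS).
Qed.

Lemma def_sup1 S : @Def1 K S -> (exists y, S y) ->
  (exists b, forall y, S y -> ~ lt b y) ->
  exists c, (forall y, S y -> ~ lt c y) /\
    forall b, (forall y, S y -> ~ lt b y) -> ~ lt b c.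
Proof.
have [c _] := scale_ex KO => DS.
exact: (def_sup (tame_omin HK) (e := fun=> c) DS).
Qed.

Lemma bdNE (S : K -> Prop) c : ~ boundary S c ->
  exists a b, [/\ lt a c, lt c b &
    forall y z, lt a y -> lt y b -> lt a z -> lt z b -> S y -> S z].
Proof.
move=> /existsNP[a /existsNP[b /not_implyP[ac /not_implyP[cb nab]]]].
exists a, b; split=> // y z ay yb az zb Sy; apply: contrapT => nSz.
by apply: nab; exists y; split=> //; exists z.
Qed.

(** The boundary point is the supremum of the initial part of [y, z] on which S
   holds. *)
Lemma bd_between_left S y z : @Def1 K S -> lt y z -> S y -> ~ S z ->
  exists c, [/\ boundary S c, ~ lt c y & ~ lt z c].
Proof.
move=> DS yz Sy Sz.
pose T t := ~ lt t y /\ ~ lt z t /\ forall s, ~ lt s y -> ~ lt t s -> S s.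
have DT : Def1 T by rewrite /T; def_tac.
have Ty : T y.
  split; first exact: lt_irr.
  split; first by move=> zy; exact: lt_irr (lt_tr KO yz zy).
  by move=> s sy ys; have [//|[->//|//]] := lt_tricho KO s y.
have [||c [cub club]] := def_sup1 DT; first by exists y.
  by exists z => t [_ []].
have cy : ~ lt c y by exact: cub.
have zc : ~ lt z c by apply: club => t [_ []].
exists c; split=> //; apply: contrapT => /bdNE[a [b [ac cb ab]]].
have bel s : ~ lt s y -> lt s c -> S s.
  move=> sy sc; apply: contrapT => nSs; apply: (club s) => // t [ty [zt tS]] st.
  by apply: nSs; apply: tS => // ts; exact: lt_irr (lt_tr KO st ts).
have Sc : S c.
  have [//|[->//|yc]] := lt_tricho KO c y.
  have [s [[sy sc] as_]] : exists s, (~ lt s y /\ lt s c) /\ lt a s.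
    have [ay|[ay|ya]] := lt_tricho KO a y.
    - by exists y; split=> //; split=> //; exact: lt_irr.
    - have [s [as_ sc]] := lt_dense KO ac; exists s; split=> //; split=> // sy.
      by subst a; exact: lt_irr (lt_tr KO as_ sy).
    - have [s [as_ sc]] := lt_dense KO ac; exists s; split=> //; split=> // sy.
      exact: lt_irr (lt_tr KO as_ (lt_tr KO sy ya)).
  apply: (ab s c) => //; last exact: bel.
  exact: lt_tr sc cb.
have zc' : lt c z by have [//|[cE|//]] := lt_tricho KO c z; subst c.
have [t [ct [tb tz]]] : exists t, lt c t /\ lt t b /\ lt t z.
  have [bz|[bz|zb]] := lt_tricho KO b z.
  - have [t [ct tb]] := lt_dense KO cb; exists t; do 2?split=> //.
    exact: lt_tr tb bz.
  - by subst b; have [t [ct tb]] := lt_dense KO cb; exists t.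
  - have [t [ct tb]] := lt_dense KO zc'; exists t; do 2?split=> //.
    exact: lt_tr tb zb.
apply: (cub t) => //; split.
  move=> ty; apply: cy; exact: lt_tr ct ty.
split=> [zt|s sy ts]; first exact: lt_irr (lt_tr KO zt tz).
have [sc|[->//|cs]] := lt_tricho KO s c; first exact: bel.
apply: (ab c s) => //; first exact: lt_tr ac cs.
have [st|[->//|//]] := lt_tricho KO s t.
exact: lt_tr st tb.
Qed.

Lemma bd_between S y z : @Def1 K S -> lt y z -> ~ (S y <-> S z) ->
  exists c, [/\ boundary S c, ~ lt c y & ~ lt z c].
Proof.
move=> DS yz yzS; have [Sy|Sy] := pselect (S y).
  by apply: bd_between_left => // Sz; apply: yzS.
have [Sz|Sz] := pselect (S z); last by exfalso; apply: yzS; split.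
have [||c [Sc cy zc]] := @bd_between_left (fun y => ~ S y) y z _ yz Sy.
- by def_tac.
- exact.
exists c; split=> // a b ac cb.
have [u [uab [v [vab [Su /contrapT Sv]]]]] := Sc a b ac cb.
by exists v; split=> //; exists u.
Qed.

Lemma fin_gap (F : K -> Prop) x : fin F ->
  exists a b, [/\ lt a x, lt x b & forall y, F y -> lt a y -> lt y b -> y = x].
Proof.
case=> k; elim: k F => [F []//|k IH F Fk].
have [[c Fc]|F0] := pselect (exists y, F y); last first.
  have [a ax] := lt_left KO x; have [b xb] := lt_right KO x.
  by exists a, b; split=> // y Fy; case: F0; exists y.
have [|a [b [ax xb Fab]]] := IH (fun y => F y /\ y <> c).
  by move=> Fk'; apply: Fk; exists c.
have Fab' a' b' : ~ lt a' a -> ~ lt b b' -> ~ (lt a' c /\ lt c b') \/ c = x ->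
    forall y, F y -> lt a' y -> lt y b' -> y = x.
  move=> a'a bb' cN y Fy ay yb; have [yc|yc] := pselect (y = c).
    by subst y; case: cN => // -[].
  apply: Fab => //.
    have [aa'|[->//|/a'a//]] := lt_tricho KO a a'; exact: lt_tr aa' ay.
  have [b'b|[<-//|/bb'//]] := lt_tricho KO b' b; exact: lt_tr yb b'b.
have [cx|[cx|xc]] := lt_tricho KO c x.
- have [ac|ac] := pselect (lt a c); last first.
    by exists a, b; split=> //; apply: Fab'; [exact: lt_irr | exact: lt_irr | left=> -[]].
  exists c, b; split=> //; apply: Fab'; [|exact: lt_irr|].
    by move=> ca; exact: lt_irr (lt_tr KO ac ca).
  by left=> -[/(lt_irr KO)].
- by exists a, b; split=> //; apply: Fab'; [exact: lt_irr | exact: lt_irr | right].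
- have [cb|cb] := pselect (lt c b); last first.
    by exists a, b; split=> //; apply: Fab'; [exact: lt_irr | exact: lt_irr | left=> -[]].
  exists a, c; split=> //; apply: Fab'; [exact: lt_irr| |].
    by move=> bc; exact: lt_irr (lt_tr KO cb bc).
  by left=> -[_ /(lt_irr KO)].
Qed.

Definition const_on (S : K -> Prop) a b :=
  (forall y, lt a y -> lt y b -> S y) \/ (forall y, lt a y -> lt y b -> ~ S y).

Lemma const_between S a b : @Def1 K S -> lt a b ->
  (forall c, lt a c -> lt c b -> ~ boundary S c) -> const_on S a b.
Proof.
move=> DS ab NS; have conn y z : lt a y -> lt y z -> lt z b -> S y <-> S z.
  move=> ay yz zb; apply: contrapT => /(bd_between DS yz)[c [Sc cy zc]].
  apply: (NS c) => //.
    by have [//|[ac|ca]] := lt_tricho KO a c; case: cy; [subst c | exact: lt_tr ca ay].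
  by have [//|[cb|bc]] := lt_tricho KO c b; case: zc; [subst c | exact: lt_tr zb bc].
have [m [am mb]] := lt_dense KO ab.
have iffm y : lt a y -> lt y b -> S y <-> S m.
  move=> ay yb; have [ym|[->//|my]] := lt_tricho KO y m; first exact: conn.
  by apply: iff_sym; exact: conn.
have [Sm|Sm] := pselect (S m); [left|right] => y ay yb.
  exact/iffm.
by move/(iffm y ay yb).
Qed.

(** Finitely many boundary points leave a gap on either side of x. *)
Lemma const_germs S x : @Def1 K S ->
  exists a b, [/\ lt a x, lt x b, const_on S a x & const_on S x b].
Proof.
move=> DS; have [a [b [ax xb abS]]] := fin_gap x (fin_bd1 DS).
exists a, b; split=> //; apply: const_between => // c c1 c2 /abS cx.
  by have cE := cx c1 (lt_tr KO c2 xb); subst c; exact: lt_irr c2.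
by have cE := cx (lt_tr KO ax c1) c2; subst c; exact: lt_irr c1.
Qed.

Lemma const_subinterval S a b : @Def1 K S -> lt a b ->
  exists a' b', [/\ lt a a', lt a' b', lt b' b & const_on S a' b'].
Proof.
move=> DS ab; have [x [ax xb]] := lt_dense KO ab.
have [_ [b1 [_ xb1 _ SS]]] := const_germs x DS.
have [b' [xb' [b'b b'b1]]] : exists b', lt x b' /\ lt b' b /\ lt b' b1.
  have [bb1|[bb1|b1b]] := lt_tricho KO b b1.
  - have [b' [xb' b'b]] := lt_dense KO xb; exists b'; do 2?split=> //.
    exact: lt_tr b'b bb1.
  - by subst b1; have [b' [xb' b'b]] := lt_dense KO xb; exists b'.
  - have [b' [xb' b'b]] := lt_dense KO xb1; exists b'; do 2?split=> //.
    exact: lt_tr b'b b1b.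
exists x, b'; split=> //.
by case: SS => SS; [left|right] => y xy yb; apply: SS => //; exact: lt_tr yb b'b1.
Qed.

(** A definable set without interior consists of boundary points. *)
Lemma infinite_interval S : @Def1 K S -> ~ fin S ->
  exists a b, lt a b /\ forall y, lt a y -> lt y b -> S y.
Proof.
move=> DS Sinf.
have [y [Sy /bdNE[a [b [ay yb abS]]]]] : exists y, S y /\ ~ boundary S y.
  apply: contrapT => H; apply: Sinf; apply: fin_sub (fin_bd1 DS) => y Sy.
  by apply: contrapT => Sy'; apply: H; exists y.
exists a, b; split; first exact: lt_tr ay yb.
by move=> z az zb; exact: (abS y z).
Qed.

End OneVariable.

(** * Definable choice and uniform scales *)

Section Choice.
Variables (K : system) (HK : tame K).

Let KD := tame_def HK.
Let KO := tame_order HK.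

Lemma choice2 (P : K -> K -> Prop) : Def2 P -> exists G : K -> K -> Prop,
  [/\ Def2 G, forall x y, G x y -> P x y,
     forall x y, P x y -> exists z, G x z
   & forall x y z, G x y -> G x z -> y = z].
Proof.
move=> DP; have [c _] := scale_ex KO.
have [G [DG GP Gex Guniq]] := tame_choice HK (Def2_at KD 1 0 DP).
exists (fun x y => G (push y (push x (fun=> c)))); split.
- exact: (Def2_at KD 1 0 (Def_push2_env KD KO (fun=> c) DG)).
- by move=> x y /GP.
- by move=> x y Pxy; apply: (Gex _ y).
- by move=> x y z; exact: Guniq.
Qed.

(** A definable choice of scales has either finitely many values, the least of
   which works for all x, or takes all values in an interval; in the latter case
   infinitely many x use a scale above a fixed interior value. *)
Lemma uniform_scale (Q : K -> K -> Prop) a b :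
  @Def2 K Q -> shrinking Q -> lt a b ->
  (forall x, lt a x -> lt x b -> exists d, scale d /\ Q x d) ->
  exists a' b' d, [/\ [/\ ~ lt a' a, lt a' b' & ~ lt b b'], scale d &
    forall x, lt a' x -> lt x b' -> Q x d].
Proof.
move=> DQ Qm ab HQ.
have [|g [Dg gP gex' guniq]] := @choice2 (fun x d => scale d /\ Q x d).
  by def_tac.
have gex x : lt a x -> lt x b -> exists d, g x d.
  by move=> ax xb; have [d Hd] := HQ x ax xb; exact: (gex' _ d).
pose Im d := exists x, (@lt K a x /\ lt x b) /\ g x d.
have DIm : Def1 Im by rewrite /Im; def_tac.
have [fIm|/(infinite_interval HK DIm)[r [s [rs rsIm]]]] := pselect (fin Im).
  have [|d [[x [_ /gP[sd _]]] dmin]] := fin_min HK fIm.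
    have [x [ax xb]] := lt_dense KO ab; have [d gd] := gex x ax xb.
    by exists d, x.
  exists a, b, d; split=> //; first by split=> //; exact: lt_irr.
  move=> y ay yb; have [d' gd'] := gex y ay yb; have [_ Qd'] := gP _ _ gd'.
  have [d'd|[<-//|dd']] := lt_tricho KO d' d; last exact: Qm dd' Qd'.
  by case: (dmin d') => //; exists y.
have [d [rd ds]] := lt_dense KO rs.
have [x [_ /gP[sd _]]] : Im d by exact: rsIm.
pose D x := (@lt K a x /\ lt x b) /\ exists d', lt d d' /\ g x d'.
have DD : Def1 D by rewrite /D; def_tac.
have [|a' [b' [a'b' DQd]]] := infinite_interval HK DD.
  move=> [k]; apply.
  have pre d' : exists x, lt d d' -> lt d' s -> (lt a x /\ lt x b) /\ g x d'.
    have [H|H] := pselect (lt d d' /\ lt d' s); last by exists d => dd' d's; case: H.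
    have [y Hy] : Im d' by case: H => dd' d's; apply: rsIm => //; exact: lt_tr rd dd'.
    by exists y.
  pose f d' := sval (cid (pre d')).
  have fP d' : lt d d' -> lt d' s -> (lt a (f d') /\ lt (f d') b) /\ g (f d') d'.
    exact: (svalP (cid (pre d'))).
  apply: (@at_least_inj _ _ k _ D f _ _ (at_least_interval HK k ds))
    => [y [dy ys]|y z [dy ys] [dz zs] fyz].
    by have [? ?] := fP y dy ys; split=> //; exists y.
  have [_ gy] := fP y dy ys; have [_ gz] := fP z dz zs.
  by rewrite fyz in gy; exact: guniq gy gz.
exists a', b', d; split=> //.
  have [m [a'm mb']] := lt_dense KO a'b'.
  split=> // [a'a|bb'].
    have [c [a'c ca]] := lt_dense KO a'a.
    have [cb'|cb'] := pselect (lt c b').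
      by have [[ac _] _] := DQd c a'c cb'; exact: lt_irr (lt_tr KO ac ca).
    have [[am _] _] := DQd m a'm mb'; have cm := lt_tr KO ca am.
    have [//|[cE|b'c]] := lt_tricho KO c b'.
      by subst c; exact: lt_irr (lt_tr KO cm mb').
    exact: lt_irr (lt_tr KO (lt_tr KO b'c cm) mb').
  have [c [bc cb']] := lt_dense KO bb'.
  have [a'c|a'c] := pselect (lt a' c).
    by have [[_ cb] _] := DQd c a'c cb'; exact: lt_irr (lt_tr KO cb bc).
  have [[_ mb] _] := DQd m a'm mb'; have mc := lt_tr KO mb bc.
  by exact: a'c (lt_tr KO a'm mc).
move=> y a'y yb'; have [_ [d' [dd' /gP[_ Qd']]]] := DQd y a'y yb'.
exact: Qm dd' Qd'.
Qed.

End Choice.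

(** * Finiteness for one parameter *)

Section Finiteness.
Variables (K : system) (HK : tame K) (A : K -> K -> Prop).
Hypotheses (DA : Def2 A) (finA : forall x, fin (A x)).

Let KD := tame_def HK.
Let KO := tame_order HK.

Lemma separated x : exists d, scale d /\
  forall y, A x y -> forall w, A x w -> proximal d y w -> y = w.
Proof.
have [|||d [sd dP]] := @fin_scale K HK (A x) (fun y d => forall w, A x w -> proximal d y w -> y = w).
- exact: finA.
- by move=> y d d' d'd H w Aw yw; apply: H => //; exact: proximal_mono yw.
- move=> y _.
  have [|||d [sd dP]] := @fin_scale K HK (A x) (fun w d => proximal d y w -> y = w).
  + exact: finA.
  + by move=> w d d' d'd H yw; apply: H => //; exact: proximal_mono yw.
  + move=> w _; have [yw|[->|wy]] := lt_tricho KO y w.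
    * have [a ay] := lt_left KO y; have [d [sd dP]] := proximal_ball KO ay yw.
      by exists d; split=> // /dP[_ /(lt_irr KO)].
    * by have [d sd] := scale_ex KO; exists d.
    * have [b yb] := lt_right KO y; have [d [sd dP]] := proximal_ball KO wy yb.
      by exists d; split=> // /dP[/(lt_irr KO)].
  + by exists d; split=> // w Aw; exact: dP.
- by exists d; split=> // y Ay w; exact: dP.
Qed.

(** The points y can be chosen definably, and by uniform_scale with a single scale
   d on a subinterval. Then the chosen points for different x are never e-close,
   although their set is infinite and definable, hence contains an interval. The
   relation o is < or >, for the two sides of x. *)
Lemma no_escape (o : K -> K -> Prop) (e a b : K) : Def2 o ->
  (forall x y, x <> y -> o x y \/ o y x) -> scale e -> lt a b ->
  ~ (forall x, lt a x -> lt x b -> exists y, A x y /\ exists d, scale d /\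
       forall x', o x x' -> proximal d x x' -> forall z, A x' z -> ~ proximal e y z).
Proof.
move=> Do o_total se ab H.
have [|g [Dg gP gex guniq]] := choice2 HK (P := fun x y => A x y /\ exists d, scale d /\
  forall x', o x x' -> proximal d x x' -> forall z, A x' z -> ~ proximal e y z).
  by def_tac.
have [||||a1 [b1 [d [[aa1 a1b1 b1b] sd Hd]]]] := @uniform_scale K HK
  (fun x d => exists y, g x y /\ forall x', o x x' -> proximal d x x' ->
     forall z, A x' z -> ~ proximal e y z) a b.
- by def_tac.
- move=> x d d' d'd [y [gy yd]]; exists y; split=> // x' ox nx; apply: yd => //.
  exact: proximal_mono nx.
- exact: ab.
- move=> x ax xb; have [y Hy] := H x ax xb; have [z gz] := gex x y Hy.
  by have [_ [d [sd dP]]] := gP _ _ gz; exists d; split=> //; exists z.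
have [a2 [b2 [a1a2 [a2b2 [b2b1 a2b2d]]]]] := proximal_small KO a1b1 sd.
have Hd' x : lt a2 x -> lt x b2 -> exists y, g x y /\ forall x', o x x' -> proximal d x x' ->
     forall z, A x' z -> ~ proximal e y z.
  by move=> ax xb; apply: Hd; [exact: lt_tr ax | exact: lt_tr xb b2b1].
have far1 x x' y y' : lt a2 x -> lt x b2 -> lt a2 x' -> lt x' b2 ->
    g x y -> g x' y' -> o x x' -> ~ proximal e y y'.
  move=> ax xb ax' xb' gy gy' oxx'; have [y0 [gy0 Hy0]] := Hd' x ax xb.
  rewrite (guniq _ _ _ gy gy0); apply: (Hy0 x') => //; first exact: a2b2d.
  by have [] := gP _ _ gy'.
have far x x' y y' : lt a2 x -> lt x b2 -> lt a2 x' -> lt x' b2 ->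
    g x y -> g x' y' -> x <> x' -> ~ proximal e y y'.
  move=> ax xb ax' xb' gy gy' /o_total[]; first exact: (far1 x x').
  by move=> ox'x /(proximal_sym KO); exact: (far1 x' x).
pose Im y := exists x, (@lt K a2 x /\ lt x b2) /\ g x y.
have DIm : Def1 Im by rewrite /Im; def_tac.
have [|r [s [rs rsIm]]] := infinite_interval HK DIm.
  move=> [k]; apply.
  have pre x : exists y, lt a2 x -> lt x b2 -> g x y.
    have [[ax xb]|nx] := pselect (lt a2 x /\ lt x b2).
      by have [y [gy _]] := Hd' x ax xb; exists y.
    by exists x => ax xb; case: nx.
  pose f x := sval (cid (pre x)).
  have fP x : lt a2 x -> lt x b2 -> g x (f x) by exact: (svalP (cid (pre x))).
  apply: (@at_least_inj _ _ k _ Im f _ _ (at_least_interval HK k a2b2)).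
    by move=> x [ax xb]; exists x; split=> //; exact: fP.
  move=> x x' [ax xb] [ax' xb'] fxx'; apply: contrapT => /far.
  move=> /(_ (f x) (f x') ax xb ax' xb'); apply; [exact: fP | exact: fP |].
  by rewrite fxx'; exact: proximal_refl.
have [r' [s' [rr' [r's' [s's near_rs]]]]] := proximal_small KO rs se.
have [y [r'y ys']] := lt_dense KO r's'.
have [y' [yy' y's']] := lt_dense KO ys'.
have r'y' := lt_tr KO r'y yy'.
have [||x [[ax xb] gx]] := rsIm y; [exact: lt_tr r'y | exact: lt_tr ys' s's |].
have [||x' [[ax' xb'] gx']] := rsIm y'; [exact: lt_tr r'y' | exact: lt_tr y's' s's |].
apply: (far x x' y y') => //; last exact: near_rs.
by move=> xx'; subst x'; rewrite (guniq _ _ _ gx gx') in yy'; exact: lt_irr yy'.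
Qed.

(** The fibres of A near x match each other, at the fixed scale e, injectively;
   so they have the same number of points. Unlike the relation of having equally
   many points, this condition is definable before the number is bounded. *)
Definition good x := exists a b e : K, (lt a x /\ lt x b) /\
  forall x', lt a x' -> lt x' b -> forall x'', lt a x'' -> lt x'' b ->
  forall y, A x' y -> exists z, A x'' z /\
    (proximal e y z /\ forall w, A x' w -> proximal e w z -> w = y).

Lemma good_bd k x : good x -> ~ boundary (fun x => at_least k (A x)) x.
Proof.
move=> [a [b [e [[ax xb] H]]]] /(_ a b ax xb).
case=> [x1 [[ax1 x1b] [x2 [[ax2 x2b] [M1 nM2]]]]]; apply: nM2.
have pre y : exists z, A x1 y -> A x2 z /\
    (proximal e y z /\ forall w, A x1 w -> proximal e w z -> w = y).
  have [Ay|nAy] := pselect (A x1 y); last by exists y => /nAy.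
  by have [z Hz] := H x1 ax1 x1b x2 ax2 x2b y Ay; exists z.
pose f y := sval (cid (pre y)).
have fP y : A x1 y -> A x2 (f y) /\
    (proximal e y (f y) /\ forall w, A x1 w -> proximal e w (f y) -> w = y).
  exact: (svalP (cid (pre y))).
apply: (@at_least_inj _ _ k _ _ f _ _ M1) => [y /fP[]//|y z Ay Az fyz].
have [_ [_ zP]] := fP z Az; apply: zP => //; rewrite -fyz.
by have [_ []] := fP y Ay.
Qed.

(** One of the finitely many points of A x has no e-close point in fibres
   arbitrarily near to x; as germs of definable sets are constant, it has none in
   all fibres near x on one side. *)
Lemma unstable_escape e x : scale e ->
  ~ (exists d, scale d /\ forall x', proximal d x x' ->
       forall y, A x y -> exists z, A x' z /\ proximal e y z) ->
  exists y, A x y /\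
    ((exists d, scale d /\ forall x', lt x x' -> proximal d x x' ->
        forall z, A x' z -> ~ proximal e y z) \/
     (exists d, scale d /\ forall x', lt x' x -> proximal d x x' ->
        forall z, A x' z -> ~ proximal e y z)).
Proof.
move=> se; apply: contra_notP => H.
have [|||d [sd dP]] := @fin_scale K HK (A x) (fun y d => forall x', proximal d x x' ->
    exists z, A x' z /\ proximal e y z).
- exact: finA.
- by move=> y d d' d'd + x' nx; apply; exact: proximal_mono nx.
- move=> y Ay.
  pose T x' := exists z, A x' z /\ proximal e y z.
  have DT : Def1 T by rewrite /T; def_tac.
  have [a [b [ax xb aS bS]]] := const_germs HK x DT.
  have [d [sd dab]] := proximal_ball KO ax xb.
  have bT x' : lt x x' -> lt x' b -> T x'.
    move=> xx' x'b; case: bS => bS; first exact: bS.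
    exfalso; apply: H; exists y; split=> //; left; exists d; split=> // x2 xx2 /dab[_ x2b] z Az nz.
    by apply: (bS x2) => //; exists z.
  have aT x' : lt a x' -> lt x' x -> T x'.
    move=> ax' x'x; case: aS => aS; first exact: aS.
    exfalso; apply: H; exists y; split=> //; right; exists d; split=> // x2 xx2 /dab[ax2 _] z Az nz.
    by apply: (aS x2) => //; exists z.
  exists d; split=> // x' /dab[ax' x'b]; have [xx'|[<-|x'x]] := lt_tricho KO x x'.
  + exact: bT.
  + by exists y; split=> //; exact: proximal_refl.
  + exact: aT.
by exists d; split=> // x' nx y Ay; exact: dP.
Qed.

(** On a subinterval all fibres are separated at one scale e0, so that with e half
   of e0 a point has at most one e-close partner. Call x stable if the points of
   A x have e-close points in all nearby fibres. Stability may be assumed to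
   hold, or to fail, on a whole interval. If it holds, uniform_scale gives good
   points; it cannot fail by no_escape, applied to the side given by
   unstable_escape. *)
Lemma good_in_interval a b : lt a b -> exists x, lt a x /\ lt x b /\ good x.
Proof.
move=> ab.
have [||||a1 [b1 [e0 [[aa1 a1b1 b1b] se0 sep]]]] := @uniform_scale K HK
  (fun x d => forall y, A x y -> forall w, A x w -> proximal d y w -> y = w) a b.
- by def_tac.
- by move=> x d d' d'd H y Ay w Aw nw; apply: H => //; exact: proximal_mono nw.
- exact: ab.
- by move=> x _ _; exact: separated.
have in1 x : lt a1 x -> lt x b1 -> lt a x /\ lt x b.
  move=> ax xb; split.
    by have [a1a|[<-//|aa1']] := lt_tricho KO a1 a; [case: aa1|exact: lt_tr aa1' ax].
  by have [b1b'|[<-//|bb1]] := lt_tricho KO b1 b; [exact: lt_tr xb b1b'|case: b1b].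
have [e [se half]] := proximal_half KO se0.
pose stable x := exists d : K, scale d /\ forall x', proximal d x x' ->
  forall y, A x y -> exists z, A x' z /\ proximal e y z.
have Dst : Def1 stable by rewrite /stable; def_tac.
have [a2 [b2 [a12 ab2 b21 [st|unst]]]] := const_subinterval HK Dst a1b1.
  have [||||a3 [b3 [d [[a23 ab3 b32] sd Hd]]]] := @uniform_scale K HK
    (fun x d => forall x', proximal d x x' ->
       forall y, A x y -> exists z, A x' z /\ proximal e y z) a2 b2.
  - by def_tac.
  - by move=> x d d' d'd + x' nx; apply; exact: proximal_mono nx.
  - exact: ab2.
  - by move=> x ax xb; have [d Hd] := st x ax xb; exists d.
  have [a4 [b4 [a34 [ab4 [b43 near4]]]]] := proximal_small KO ab3 sd.
  have [x [ax xb]] := lt_dense KO ab4.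
  have in3 y : lt a4 y -> lt y b4 -> lt a3 y /\ lt y b3.
    by move=> ay yb; split; [exact: lt_tr ay | exact: lt_tr yb b43].
  have in2 y : lt a4 y -> lt y b4 -> lt a1 y /\ lt y b1.
    move=> /in3 /[apply] -[ay yb]; split.
      have [aa|[aa|aa]] := lt_tricho KO a3 a2; first by case: a23.
        by subst a3; exact: lt_tr ay.
      exact: lt_tr a12 (lt_tr KO aa ay).
    have [bb|[bb|bb]] := lt_tricho KO b3 b2; last by case: b32.
      exact: lt_tr yb (lt_tr KO bb b21).
    by subst b3; exact: lt_tr yb b21.
  exists x; have [ax1 xb1] := in2 x ax xb; have [ax0 xb0] := in1 x ax1 xb1.
  split=> //; split=> //; exists a4, b4, e; split=> // x' ax' xb' x'' ax'' xb'' y Ay.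
  have [az zb] := in3 x' ax' xb'.
  have [z [Az yz]] := Hd x' az zb x'' (near4 _ _ ax' xb' ax'' xb'') y Ay.
  exists z; split=> //; split=> // w Aw wz; apply: (sep x') => //.
  - by have [] := in2 x' ax' xb'.
  - by have [] := in2 x' ax' xb'.
  - exact: half wz yz.
exfalso.
pose rightward x := exists y, A x y /\ exists d : K, scale d /\
  forall x', lt x x' -> proximal d x x' -> forall z, A x' z -> ~ proximal e y z.
have Dr : Def1 rightward by rewrite /rightward; def_tac.
have [a3 [b3 [a23 ab3 b32 [r|nr]]]] := const_subinterval HK Dr ab2.
  apply: (@no_escape lt e a3 b3) => //; first exact: Def_lt01.
  by move=> x y; have [|[]] := lt_tricho KO x y; auto.
apply: (@no_escape (fun x x' => lt x' x) e a3 b3) => //; first by def_tac.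
  by move=> x y; have [|[]] := lt_tricho KO x y; auto.
move=> x ax xb; have /unst : lt a2 x by exact: lt_tr ax.
move=> /(_ (lt_tr KO xb b32)) /(unstable_escape se)[y [Ay [yr|yl]]].
  by exfalso; apply: (nr x) => //; exists y.
by exists y.
Qed.

Lemma bad_fin : fin (fun x => ~ good x).
Proof.
have Dg : Def1 (fun x => ~ good x) by rewrite /good; def_tac.
apply: contrapT => /(infinite_interval HK Dg)[a [b [/good_in_interval[x [ax [xb gx]]] H]]].
exact: (H x).
Qed.

(** The number of points of A x is constant on intervals of good points, and the
   finitely many bad points leave finitely many of these. The induction is on the
   number of bad points in the final segment U. *)
Lemma bounded_above k (U : K -> Prop) : (forall x y, U x -> lt x y -> U y) ->
  ~ at_least k (fun x => ~ good x /\ U x) -> exists N, forall x, U x -> ~ at_least N (A x).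
Proof.
have conn x y N : lt x y -> (forall z, ~ lt z x -> ~ lt y z -> good z) ->
    at_least N (A x) <-> at_least N (A y).
  move=> xy g; apply: contrapT => H.
  have [|z [zbd zx yz]] := bd_between HK (S := fun x => at_least N (A x)) _ xy H.
    by def_tac.
  by apply: good_bd zbd; exact: g.
have sample (V : K -> Prop) : (forall x y z, V x -> V y -> ~ lt z x -> ~ lt y z -> good z) ->
    exists N, forall x, V x -> ~ at_least N (A x).
  move=> Vg; have [[x0 Vx0]|V0] := pselect (exists x, V x); last first.
    by exists 0 => x Vx; case: V0; exists x.
  have [N HN] := finA x0; exists N => x Vx M; apply: HN.
  have [xx0|[<-//|x0x]] := lt_tricho KO x x0.
    by apply/(conn x x0 N) => // z; exact: Vg.
  by apply/(conn x0 x N) => // z; exact: Vg.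
elim: k U => [U _ Uk|k IH U Uup Uk]; first by exfalso; apply: Uk.
have [[x0 [bx0 Ux0]]|H] := pselect (exists x, ~ good x /\ U x); last first.
  apply: sample => x y z Ux Uy zx yz; apply: contrapT => bz; apply: H; exists z; split=> //.
  have [xz|[<-//|//]] := lt_tricho KO x z; exact: Uup xz.
have [||c [[bc Uc] cmin]] := fin_min HK (F := fun x => ~ good x /\ U x).
- by exists k.+1.
- by exists x0.
have [||N1 HN1] := IH (fun x => lt c x).
- by move=> x y cx xy; exact: lt_tr cx xy.
- move=> M; apply: Uk; exists c; split=> //; apply: at_least_sub M => x [bx cx].
  by split; [split=> //; exact: Uup cx | move=> xc; subst x; exact: lt_irr cx].
have [|N2 HN2] := sample (fun x => U x /\ lt x c).
  move=> x y z [Ux xc] [Uy yc] zx yz; apply: contrapT => bz.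
  have zc : lt z c.
    by have [zy|[->//|//]] := lt_tricho KO z y; exact: lt_tr zy yc.
  apply: (cmin z) => //; split=> //.
  by have [xz|[<-//|//]] := lt_tricho KO x z; exact: Uup xz.
have [N3 HN3] := finA c.
exists (maxn N1 (maxn N2 N3)) => x Ux M.
have [xc|[xc|cx]] := lt_tricho KO x c.
- apply: (HN2 x); first by split.
  by apply: at_least_leq M; rewrite !leq_max leqnn orbT.
- by subst x; apply: HN3; apply: at_least_leq M; rewrite !leq_max leqnn !orbT.
- by apply: (HN1 x) => //; apply: at_least_leq M; rewrite leq_max leqnn.
Qed.

Theorem finiteness : exists N, forall x, ~ at_least N (A x).
Proof.
have [k Hk] := bad_fin.
have [||N HN] := @bounded_above k (fun=> True); [by []| |by exists N => x; exact: HN].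
by move=> M; apply: Hk; apply: at_least_sub M => x [].
Qed.

End Finiteness.

Lemma push_eta (T : Type) (e : nat -> T) : push (e 0) (fun i => e i.+1) = e.
Proof. by apply: funext => -[]. Qed.

Lemma push_comp (T U : Type) (f : T -> U) y (e : nat -> T) :
  (fun i => f (push y e i)) = push (f y) (fun i => f (e i)).
Proof. by apply: funext => -[]. Qed.

(** * Definable ultrapowers *)

Section Ultrapower.
Variables (K : system) (HK : tame K) (p : set (set K)).
Hypothesis Hp : UltraFilter p.

Let KD := tame_def HK.
Let KO := tame_order HK.

Local Notation ae S := (p S).

Let aeT (S : K -> Prop) : (forall x, S x) -> ae S.
Proof. by move=> HS; apply: filterS (@filterT _ p _) => x _; exact: HS. Qed.

Let aeN (S : K -> Prop) : ae (fun x => ~ S x) <-> ~ ae S.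
Proof.
split=> [NS HS|NS].
  apply: (@filter_not_empty _ p _); apply: filterS (filterI NS HS) => x [].
  by [].
by have [//|] := in_ultra_setVsetC S Hp.
Qed.

(** The points of the ultrapower are definable functions of an index x in K, up to
   equality almost everywhere with respect to the ultrafilter p. Since other
   functions are left out, a set definable in the ultrapower comes from a
   definable family with the single parameter x. *)
Definition germ (g : K -> K) : set (K -> K) := fun h => ae (fun x => g x = h x).

Definition graph (g : K -> K) := Def2 (fun x y => y = g x).

Definition ultrapoint := {S : set (K -> K) | exists g, graph g /\ S = germ g}.

Definition repr (u : ultrapoint) : K -> K := sval (cid (svalP u)).

Lemma graph_repr u : graph (repr u).
Proof. by have [] := svalP (cid (svalP u)). Qed.

Lemma germ_repr u : sval u = germ (repr u).
Proof. by have [] := svalP (cid (svalP u)). Qed.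

Definition ultra (g : K -> K) (Dg : graph g) : ultrapoint :=
  exist _ (germ g) (ex_intro _ g (conj Dg erefl)).

Lemma repr_ultra g (Dg : graph g) : ae (fun x => g x = repr (ultra Dg) x).
Proof.
have : germ g (repr (ultra Dg)) by rewrite -[germ g]/(sval (ultra Dg)) germ_repr; exact: aeT.
by [].
Qed.

Lemma ultra_eq u v : ae (fun x => repr u x = repr v x) -> u = v.
Proof.
move=> uv; have : sval u = sval v.
  rewrite !germ_repr; apply/seteqP; split=> h; rewrite /germ => H.
    by apply: filterS (filterI uv H) => x [<-].
  by apply: filterS (filterI uv H) => x [->].
case: u v {uv} => [S HS] [S' HS'] /= SS'; subst S'.
by congr exist; exact: Prop_irrelevance.
Qed.

Definition at_index (e : nat -> ultrapoint) (x : K) : nat -> K :=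
  fun i => repr (e i) x.

(** The theorem of Los holds for P' in this form; the family P may depend on the
   index x. *)
Definition induced (P : K -> (nat -> K) -> Prop) (P' : (nat -> ultrapoint) -> Prop) :=
  Def (fun e => P (e 0) (fun i => e i.+1)) /\
  forall e, P' e <-> ae (fun x => P x (at_index e x)).

Definition ultrapower : system := {|
  elt := ultrapoint;
  lt u v := ae (fun x => lt (repr u x) (repr v x));
  scale u := ae (fun x => scale (repr u x));
  proximal u v w := ae (fun x => proximal (repr u x) (repr v x) (repr w x));
  Def P' := exists P, induced P P' |}.

Local Notation U := ultrapower.
Implicit Types (P Q : K -> (nat -> K) -> Prop).

Lemma at_index_push (y : U) (e : nat -> U) x :
  at_index (@push U y e) x = push (repr y x) (at_index e x).
Proof. exact: (push_comp (fun u => repr u x)). Qed.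

Lemma induced_intro P : Def (fun e => P (e 0) (fun i => e i.+1)) ->
  induced P (fun e : nat -> U => ae (fun x => P x (at_index e x))).
Proof. by []. Qed.

Lemma induced_ren P (P' : (nat -> U) -> Prop) s : induced P P' ->
  induced (fun x e => P x (fun i => e (s i))) (fun e => P' (fun i => e (s i))).
Proof.
move=> [DP HP]; split=> [|e]; last exact: HP.
by apply: (Def_ren KD (fun i => if i is j.+1 then (s j).+1 else 0) DP).
Qed.

Lemma induced_push P (P' : (nat -> U) -> Prop) a s : induced P P' ->
  induced (fun x e => P x (push (e a) (fun i => e (s i))))
          (fun e => P' (push (e a) (fun i => e (s i)))).
Proof.
move=> /(induced_ren (fun i => if i is j.+1 then s j else a)).
by congr induced; do ?[apply: funext => ?]; congr (_ _); apply: funext => -[].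
Qed.

Lemma induced_and P (P' : (nat -> U) -> Prop) Q (Q' : (nat -> U) -> Prop) :
  induced P P' -> induced Q Q' ->
  induced (fun x e => P x e /\ Q x e) (fun e => P' e /\ Q' e).
Proof.
move=> [DP HP] [DQ HQ]; split=> [|e]; first by apply: Def_and.
rewrite HP HQ; split=> [[Pe Qe]|PQe]; first exact: filterI.
by split; apply: filterS PQe => x [].
Qed.

Lemma induced_not P (P' : (nat -> U) -> Prop) : induced P P' ->
  induced (fun x e => ~ P x e) (fun e => ~ P' e).
Proof. by move=> [DP HP]; split=> [|e]; [apply: Def_not | rewrite HP -aeN]. Qed.

Lemma induced_eqv P (P' : (nat -> U) -> Prop) Q (Q' : (nat -> U) -> Prop) :
  (forall x e, P x e <-> Q x e) ->
  (forall e, P' e <-> Q' e) -> induced P P' -> induced Q Q'.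
Proof.
move=> PQ PQ'.
have -> : P = Q by apply: funext => x; apply: funext => e; exact/propext.
by have -> : P' = Q' by apply: funext => e; exact/propext.
Qed.

Lemma induced_or P (P' : (nat -> U) -> Prop) Q (Q' : (nat -> U) -> Prop) :
  induced P P' -> induced Q Q' ->
  induced (fun x e => P x e \/ Q x e) (fun e => P' e \/ Q' e).
Proof.
move=> /induced_not HP /induced_not HQ.
apply: induced_eqv (induced_not (induced_and HP HQ)) => [x e|e];
  by rewrite not_andP !notK.
Qed.

Lemma induced_imp P (P' : (nat -> U) -> Prop) Q (Q' : (nat -> U) -> Prop) :
  induced P P' -> induced Q Q' ->
  induced (fun x e => P x e -> Q x e) (fun e => P' e -> Q' e).
Proof.
move=> /induced_not HP HQ.
by apply: induced_eqv (induced_or HP HQ) => [x e|e]; rewrite implyE.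
Qed.

Lemma Def_at_index2 P (e : nat -> U) : Def (fun e => P (e 0) (fun i => e i.+1)) ->
  Def2 (fun x y => P x (push y (at_index e x))).
Proof.
move=> DP.
apply: (Def_iff _ (Def_subst KD (t := fun i f => if i is j.+1 then
   if j is k.+1 then repr (e k) (f 0) else f 1 else f 0) DP _)).
  by move=> f; apply: eq_iff; congr (P _ _); apply: funext => -[].
case=> [|[|i]]; [exact: Def_eq|exact: Def_eq|].
exact: (Def2_at KD 1 0 (graph_repr (e i))).
Qed.

(** The existential step of the theorem of Los: witnesses are chosen definably
   in the index, so they form a point of the ultrapower. *)
Lemma induced_ex (Q : K -> (nat -> K) -> K -> Prop) (Q' : (nat -> U) -> U -> Prop) :
  induced (fun x e => Q x (fun i => e i.+1) (e 0))
          (fun e => Q' (fun i => e i.+1) (e 0)) ->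
  induced (fun x e => exists y, Q x e y) (fun e => exists y, Q' e y).
Proof.
move=> [DQ HQ]; split=> [|e].
  apply: Def_exists => //.
  by apply: (Def_ren KD (fun i => if i is j.+1 then if j is k.+1 then k.+2 else 0 else 1) DQ).
have HQe y : Q' e y <-> ae (fun x => Q x (at_index e x) (repr y x)).
  exact: (HQ (push y e)).
split=> [[y /HQe Qy]|Qx]; first by apply: filterS Qy => x; exists (repr y x).
have DQe : Def2 (fun x y => Q x (at_index e x) y).
  exact: (Def_at_index2 e (P := fun x e => Q x (fun i => e i.+1) (e 0)) DQ).
have [G [DG GQ Gex Guniq]] := choice2 HK DQe.
pose g x := if pselect (exists y, G x y) is left H then sval (cid H) else x.
have gG x : (exists y, G x y) -> G x (g x).
  by rewrite /g; case: pselect => // H _; exact: svalP.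
have Dg : graph g.
  have DG' : Def2 (fun x y => G x y \/ (~ (exists z, G x z)) /\ y = x) by def_tac.
  apply: Def_iff DG' => f; split=> [[Gf|[nG ->]]|->].
  - exact: (Guniq _ _ _ Gf (gG _ (ex_intro _ _ Gf))).
  - by rewrite /g; case: pselect => // H; case: (nG H).
  - have [|nG] := pselect (exists z, G (f 0) z); first by move/gG; left.
    by right; split=> //; rewrite /g; case: pselect => // H; case: (nG H).
exists (ultra Dg); apply/HQe; apply: filterS (filterI Qx (repr_ultra Dg)) => x [[y Qy] <-].
by apply: GQ; apply: gG; exact: Gex Qy.
Qed.

Lemma induced_all (Q : K -> (nat -> K) -> K -> Prop) (Q' : (nat -> U) -> U -> Prop) :
  induced (fun x e => Q x (fun i => e i.+1) (e 0))
          (fun e => Q' (fun i => e i.+1) (e 0)) ->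
  induced (fun x e => forall y, Q x e y) (fun e => forall y, Q' e y).
Proof.
move=> HQ; apply: (induced_eqv _ _ (induced_not (induced_ex (Q := fun x e y => ~ Q x e y)
  (Q' := fun e y => ~ Q' e y) (induced_not HQ)))) => [x e|e].
  by split=> [H y|H [y]]; [apply: contrapT => NQ; apply: H; exists y | apply].
by split=> [H y|H [y]]; [apply: contrapT => NQ; apply: H; exists y | apply].
Qed.

Lemma induced_lt i j : induced (fun x e => lt (e i) (e j))
  (fun e : nat -> U => lt (e i) (e j)).
Proof. by split=> // ; apply: Def_lt. Qed.

Lemma induced_scale i : induced (fun x e => scale (e i))
  (fun e : nat -> U => scale (e i)).
Proof. by split=> // ; apply: Def_scale. Qed.

Lemma induced_proximal i j k : induced (fun x e => proximal (e i) (e j) (e k))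
  (fun e : nat -> U => proximal (e i) (e j) (e k)).
Proof. by split=> // ; apply: Def_proximal. Qed.

Lemma induced_eq i j : induced (fun x e => e i = e j)
  (fun e : nat -> U => e i = e j).
Proof.
split=> [|e]; first exact: Def_eq.
split=> [ij|]; last exact: ultra_eq.
by apply: aeT => x; rewrite /at_index ij.
Qed.

Lemma induced_true : induced (fun x e => True) (fun e : nat -> U => True).
Proof. by split=> [|e]; [exact: Def_true | split=> // _; exact: aeT]. Qed.

Lemma induced_at_least k (Q : K -> (nat -> K) -> K -> Prop) (Q' : (nat -> U) -> U -> Prop) :
  induced (fun x e => Q x (fun i => e i.+1) (e 0))
          (fun e => Q' (fun i => e i.+1) (e 0)) ->
  induced (fun x e => at_least k (Q x e)) (fun e => at_least k (Q' e)).
Proof.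
elim: k Q Q' => [|k IH] Q Q' HQ /=; first exact: induced_true.
apply: induced_ex; apply: induced_and => //.
apply: (IH (fun x e z => Q x (fun i => e i.+1) z /\ z <> e 0)
           (fun e z => Q' (fun i => e i.+1) z /\ z <> e 0)).
apply: induced_and; last by apply: induced_not; exact: induced_eq.
exact: (induced_ren (fun i => if i is j.+1 then j.+2 else 0) HQ).
Qed.

Lemma induced_bd j (Q : K -> (nat -> K) -> K -> Prop) (Q' : (nat -> U) -> U -> Prop) :
  induced (fun x e => Q x (fun i => e i.+1) (e 0))
          (fun e => Q' (fun i => e i.+1) (e 0)) ->
  induced (fun x e => boundary (Q x e) (e j)) (fun e => boundary (Q' e) (e j)).
Proof.
move=> HQ; rewrite /boundary.
do 2 apply: induced_all; do 2 (apply: induced_imp; first exact: induced_lt).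
apply: induced_ex; apply: induced_and.
  by apply: induced_and => //; exact: induced_lt.
apply: induced_ex; apply: induced_and.
  by apply: induced_and => //; exact: induced_lt.
apply: induced_and.
  exact: (induced_ren (fun i => if i is j.+1 then j.+4 else 1) HQ).
apply: induced_not.
exact: (induced_ren (fun i => if i is j.+1 then j.+4 else 0) HQ).
Qed.

Lemma transfer (phi phi' : Prop) : induced (fun _ _ => phi) (fun _ => phi') ->
  phi -> phi'.
Proof.
move=> [_ H] Hphi; have [c _] := scale_ex KO.
have Dc : graph (fun=> c) by rewrite /graph; def_tac.
by apply/(H (fun=> ultra Dc)); exact: aeT.
Qed.

Ltac ind_step :=
  lazymatch goal with
  | |- induced _ (fun e => (_ /\ _)) => apply: induced_and
  | |- induced _ (fun e => (_ \/ _)) => apply: induced_or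
  | |- induced _ (fun e => ~ _) => apply: induced_not
  | |- induced _ (fun e => (exists y, _)) => apply: induced_ex
  | |- induced _ (fun e => (forall y, _)) =>
      first [apply: induced_imp | apply: induced_all]
  | |- induced _ (fun e => lt _ _) => apply: induced_lt
  | |- induced _ (fun e => scale _) => apply: induced_scale
  | |- induced _ (fun e => proximal _ _ _) => apply: induced_proximal
  | |- induced _ (fun e => _ = _) => apply: induced_eq
  | |- _ => match goal with H : induced _ _ |- _ => apply: (induced_push _ _ H) end
  end.

Ltac ind_tac := repeat (ind_step; cbv beta).

Lemma ultra_order : uniform_order U.
Proof.
split.
- by move: (lt_irr KO); apply: transfer; ind_tac.
- by move: (lt_tr KO); apply: transfer; ind_tac.
- by move: (lt_tricho KO); apply: transfer; ind_tac.
- by move: (lt_dense KO); apply: transfer; ind_tac.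
- by move: (lt_left KO); apply: transfer; ind_tac.
- by move: (lt_right KO); apply: transfer; ind_tac.
- by move: (scale_ex KO); apply: transfer; ind_tac.
- by move: (proximal_refl KO); apply: transfer; ind_tac.
- by move: (proximal_sym KO); apply: transfer; ind_tac.
- by move: (proximal_mono KO); apply: transfer; ind_tac.
- by move: (proximal_half KO); apply: transfer; ind_tac.
- by move: (proximal_ball KO); apply: transfer; ind_tac.
- by move: (proximal_small KO); apply: transfer; ind_tac.
Qed.

Lemma ultra_definability : definability U.
Proof.
split.
- by move=> P' Q' [P HP] [Q HQ]; exists (fun x e => P x e /\ Q x e); exact: induced_and.
- by move=> P' [P HP]; exists (fun x e => ~ P x e); exact: induced_not.
- move=> P' [P HP]; exists (fun x e => exists y, P x (push y e)).
  by apply: induced_ex; exact: induced_push.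
- by move=> P' s [P HP]; exists (fun x e => P x (fun i => e (s i))); exact: induced_ren.
- by exists (fun x e => lt (e 0) (e 1)); exact: induced_lt.
- by exists (fun x e => scale (e 0)); exact: induced_scale.
- by exists (fun x e => proximal (e 0) (e 1) (e 2)); exact: induced_proximal.
- move=> c; exists (fun x e => e 0 = repr c x); split=> [|e].
    exact: (Def2_at KD 0 1 (graph_repr c)).
  split=> [ec|]; last exact: ultra_eq.
  by apply: aeT => x; rewrite /at_index ec.
- move=> P' [P [DP HP]]; have [n Hn] := Def_supp KD DP.
  exists n => e e' ee' /HP Pe; apply/HP; apply: filterS Pe => x.
  apply: (Hn (push x (at_index e x)) (push x (at_index e' x))) => -[//|i] /ltnW /ee'.
  by rewrite /= /at_index => ->.
Qed.

(** Here the finiteness theorem is needed: o-minimality of K bounds the boundary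
   points for each index, and the ultrapower needs a bound for all indices. *)
Lemma ultra_omin : o_minimal_system U.
Proof.
split=> P' e [P HP].
- have DB : Def2 (fun x y => P x (push y (at_index e x))) := Def_at_index2 e HP.1.
  have [||N HN] := finiteness HK (A := fun x => boundary (fun y => P x (push y (at_index e x)))).
  + by def_tac.
  + move=> x; apply: (fin_bd1 HK).
    exact: (Def_param KD (F := fun x f => P x (push (f 0) (at_index e x))) x (Def2_at KD 0 1 DB)).
  exists N.
  have [_ H] : induced (fun x e => ~ at_least N (boundary (fun y => P x (push y e))))
                       (fun e : nat -> U => ~ at_least N (boundary (fun y => P' (push y e)))).
    apply: induced_not; apply: induced_at_least; apply: induced_bd.
    exact: induced_push.
  by apply/H; apply: aeT.
- have [_ H] : induced (fun x e =>
      (exists y, P x (push y e)) ->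
      (exists b, forall y, P x (push y e) -> ~ lt b y) ->
      exists c, (forall y, P x (push y e) -> ~ lt c y) /\
      forall b, (forall y, P x (push y e) -> ~ lt b y) -> ~ lt b c)
    (fun e : nat -> U =>
      (exists y, P' (push y e)) ->
      (exists b, forall y, P' (push y e) -> ~ lt b y) ->
      exists c, (forall y, P' (push y e) -> ~ lt c y) /\
      forall b, (forall y, P' (push y e) -> ~ lt b y) -> ~ lt b c).
    by ind_tac.
  apply/H; apply: aeT => x.
  have DS : Def1 (fun y => P x (push y (at_index e x))).
    exact: (Def_param KD (F := fun x f => P x (push (f 0) (at_index e x))) x (Def2_at KD 0 1 (Def_at_index2 e HP.1))).
  by move: (def_sup1 HK DS) => H0 ?; apply: H0.
Qed.

Lemma ultra_choice : uniformizable U.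
Proof.
move=> P' [P [DP HP]].
have DP1 : Def (fun e => P (e 1) (push (e 0) (fun i => e i.+2))).
  apply: Def_iff (Def_ren KD (fun i => if i is j.+1 then if j is k.+1 then k.+2 else 0 else 1) DP) => e.
  by apply: eq_iff; congr (P _ _); apply: funext => -[].
have [Q1 [DQ1 QP Qex Quniq]] := tame_choice HK DP1.
pose Q x (e : nat -> K) := Q1 (push (e 0) (push x (fun i => e i.+1))).
have HQ : induced Q (fun e : nat -> U => ae (fun x => Q x (at_index e x))).
  apply: induced_intro.
  apply: Def_iff (Def_ren KD (fun i => if i is j.+1 then if j is k.+1 then k.+2 else 0 else 1) DQ1) => e.
  by apply: eq_iff; congr Q1; apply: funext => -[|[]].
exists (fun e => ae (fun x => Q x (at_index e x))); split.
- by exists Q.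
- move=> e Qe; apply/HP; apply: filterS Qe => x /QP /=.
  by rewrite push_eta.
- move=> e y /HP Py.
  have [_ H] : induced (fun x e => exists z, Q x (push z e))
     (fun e : nat -> U => exists z, ae (fun x => Q x (at_index (push z e) x))).
    by apply: induced_ex; exact: (induced_push 0 succn HQ).
  apply/H; apply: filterS Py => x Py.
  apply: (Qex (push x (at_index e x)) (repr y x)).
  exact: (eq_ind _ (P x) Py _ (at_index_push y e x)).
- move=> e y z Qy Qz; apply: ultra_eq; apply: filterS (filterI Qy Qz) => x [Qyx Qzx].
  have := eq_ind _ (Q x) Qzx _ (at_index_push z e x).
  have := eq_ind _ (Q x) Qyx _ (at_index_push y e x).
  exact: Quniq.
Qed.

Theorem ultra_tame : tame U.
Proof.
split; last exact: ultra_choice.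
by split; [exact: ultra_definability | exact: ultra_order | exact: ultra_omin].
Qed.

End Ultrapower.

(** * Uniform finiteness *)

Definition prepend (T : Type) (j : nat) (g e : nat -> T) : nat -> T :=
  fun i => if i < j then g i else e (i - j).

Lemma prependS (T : Type) j (g e : nat -> T) :
  prepend j.+1 g e = prepend j g (push (g j) e).
Proof.
apply: funext => i; rewrite /prepend ltnS.
have [ij|ji|->] := ltngtP i j => //; last by rewrite subnn.
by rewrite -[i in RHS](subnK ji) addnS -addSn addnK.
Qed.

Lemma push_prepend (T : Type) j y (g e : nat -> T) :
  push y (prepend j g e) = prepend j.+1 (push y g) e.
Proof. by apply: funext => -[|i]. Qed.

Lemma prepend_prepend (T : Type) j (g e e' : nat -> T) :
  prepend j (prepend j g e) e' = prepend j g e'.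
Proof. by apply: funext => i; rewrite /prepend; case: ifP => // ->. Qed.

(** The theorem of Los treats one quantifier at a time, so the quantification over
   the j entries of [prepend j g e] has to be unfolded into single ones. *)
Fixpoint exs (T : Type) j (Z : (nat -> T) -> Prop) : (nat -> T) -> Prop :=
  if j is i.+1 then exs i (fun e => exists y, Z (push y e)) else Z.

Lemma exsP (T : Type) j (Z : (nat -> T) -> Prop) e :
  exs j Z e <-> exists g, Z (prepend j g e).
Proof.
have E g : prepend 0 g e = e.
  by apply: funext => i; rewrite /prepend subn0.
elim: j Z => [|j IH] Z /=.
  by split=> [Ze|[g]]; [exists e|]; rewrite E.
rewrite IH; split=> [[g [y]]|[g]]; first by rewrite push_prepend; exists (push y g).
move=> Zg; exists (fun i => g i.+1), (g 0).
by rewrite push_prepend push_eta.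
Qed.

Lemma induced_exs (K : system) (HK : tame K) (p : set (set K))
    (Hp : UltraFilter p) j (Z : K -> (nat -> K) -> Prop)
    (Z' : (nat -> ultrapower p) -> Prop) :
  induced Z Z' -> induced (fun x => exs j (Z x)) (exs j Z').
Proof.
elim: j Z Z' => //= j IH Z Z' HZ; apply: (IH (fun x e => exists y, Z x (push y e))).
by apply: induced_ex => //; exact: (induced_push HK 0 succn HZ).
Qed.

(** Uniform bounds in j parameters, for all tame structures at once, by
   induction on j. If there were no bound, the sets of values x of the last
   parameter for which k boundary points occur would generate a filter; in the
   ultrapower along an ultrafilter that contains it, x has become a constant,
   and the bound for one parameter less is violated. *)
Lemma uniform_finiteness_prepend j (K : system) (HK : tame K)
    (P : (nat -> K) -> Prop) e : Def P ->
  exists N, forall g, ~ at_least N (boundary (fun y => P (push y (prepend j g e)))).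
Proof.
elim: j K HK P e => [|j IH] K HK P e DP.
  have [N HN] := fin_bd (tame_omin HK) e DP; exists N => g M; apply: HN.
  apply: at_least_sub M => c; rewrite (_ : prepend 0 g e = e) //.
  by apply: funext => i; rewrite /prepend subn0.
apply: contrapT => H.
have {}H N : exists g, at_least N (boundary (fun y => P (push y (prepend j.+1 g e)))).
  by apply: contrapT => H'; apply: H; exists N => g M; apply: H'; exists g.
pose W N : set K := [set x | exists g,
  at_least N (boundary (fun y => P (push y (prepend j g (push x e)))))].
pose F : set (set K) := [set S | exists N, (W N `<=` S)%classic].
have FF : ProperFilter F.
  split.
    by move=> [N WN]; have [g Hg] := H N; apply: (WN (g j)); exists g; rewrite -prependS.
  split.
  - by exists 0.
  - move=> S T [N NS] [M MT]; exists (maxn N M) => x [g Wg].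
    split; [apply: NS | apply: MT]; exists g; apply: at_least_leq Wg;
      by rewrite leq_max leqnn ?orbT.
  - by move=> S T ST [N NS]; exists N; exact: subset_trans NS ST.
have [p [Hp Fp]] := ultraFilterLemma FF.
pose P1 (x : K) (f : nat -> K) :=
  P (push (f 0) (prepend j (fun i => f i.+1) (push x e))).
have DP1 : Def (fun e => P1 (e 0) (fun i => e i.+1)).
  apply: (Def_iff _ (Def_subst (tame_def HK) (t := fun i f => if i is i'.+1 then
    if i' < j then f i'.+2 else if i' - j is k.+1 then e k else f 0 else f 1) DP _)).
    by [].
  case=> [|i]; first exact: (Def_eq (tame_def HK) (tame_order HK) 0 2).
  case: (i < j); first exact: (Def_eq (tame_def HK) (tame_order HK) 0 i.+3).
  case: (i - j) => [|k]; last exact: (Def_const0 (tame_def HK)).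
  exact: (Def_eq (tame_def HK) (tame_order HK) 0 1).
have indP1 := induced_intro p DP1.
have [c0 _] := scale_ex (tame_order (ultra_tame HK Hp)).
have [|N HN] := IH _ (ultra_tame HK Hp)
  (fun f => p [set x | P1 x (at_index f x)]) (fun=> c0).
  by exists P1.
have := @induced_exs K HK p Hp j (fun x f => at_least N (boundary (fun y => P1 x (push y f))))
  (fun f => at_least N (boundary (fun y => p [set x | P1 x (at_index (push y f) x)]))).
case.
  apply: induced_at_least => //; apply: induced_bd => //.
  exact: (induced_push HK 0 (fun i => i.+2) indP1).
move=> _ /(_ (fun=> c0))[_] bounded.
have /exsP[g] : exs j (fun f : nat -> ultrapower p => at_least N (boundary (fun y : ultrapower p =>
    p [set x | P1 x (at_index (push y f) x)]))) (fun=> c0).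
  apply: bounded; have : p (W N) by apply: Fp; exists N.
  apply: filterS => x [g Wg]; apply/exsP; exists g.
  by apply: at_least_sub Wg => c; rewrite /P1 /= prepend_prepend.
exact: HN.
Qed.

Theorem uniform_finiteness (K : system) (HK : tame K) (P : (nat -> K) -> Prop) :
  Def P -> exists N, forall e, ~ at_least N (boundary (fun y => P (push y e))).
Proof.
(* P reads n entries of the environment only. *)
move=> DP; have [n Hn] := Def_supp (tame_def HK) DP.
have [c _] := scale_ex (tame_order HK).
have [N HN] := uniform_finiteness_prepend n HK (fun=> c) DP.
exists N => e; rewrite (_ : (fun y => _) = fun y => P (push y (prepend n e (fun=> c)))).
  exact: HN.
have E y i : i < n -> push y e i = push y (prepend n e (fun=> c)) i.
  by case: i => //= i /ltnW; rewrite /prepend => ->.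
by apply: funext => y; apply/propext; split; apply: Hn => i /E.
Qed.

(** * Counting traces *)

(** The chain is s_k < ... < s_1 < t, and membership in S changes at each step. *)
Fixpoint altn (K : system) (k : nat) (S : K -> Prop) (t : K) : Prop :=
  if k is j.+1 then exists s, lt s t /\ (~ (S s <-> S t) /\ altn j S s) else True.

Section Alternations.
Variables (K : system) (HK : tame K).

Let KD := tame_def HK.
Let KO := tame_order HK.

Lemma altn_pred k (S : K -> Prop) t : altn k.+1 S t -> altn k S t.
Proof.
by elim: k t => //= k IH t [s [st [sS /IH kS]]]; exists s.
Qed.

Lemma altn_up k (S : K -> Prop) t t' : lt t t' -> altn k S t -> altn k S t'.
Proof.
case: k => // k tt' tk; have [E|NE] := pselect (S t <-> S t').
  case: tk => s [st [sS sk]]; exists s; split; first exact: lt_tr st tt'.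
  by split=> // sE; apply: sS; split=> ?; [apply/E/sE | apply/sE/E].
by exists t; split=> //; split=> //; exact: altn_pred.
Qed.

(** A boundary point lies between any two consecutive elements of the chain; every
   second gap is used, so that these points are distinct. *)
Lemma altn_at_least_bd k S t : @Def1 K S -> altn k.*2 S t ->
  at_least k (fun c => boundary S c /\ ~ lt t c).
Proof.
move=> DS; elim: k t => //= k IH t [s [st [sS [r [rs [_ rk]]]]]].
have [c [Sc cs tc]] := bd_between HK DS st sS.
exists c; split=> //; apply: at_least_sub (IH r rk) => d [Sd rd].
have dc : lt d c.
  have ds : lt d s by have [dr|[->//|//]] := lt_tricho KO d r; exact: lt_tr dr rs.
  by have [sc|[<-//|//]] := lt_tricho KO s c; exact: lt_tr ds sc.
split; last by move=> dE; subst d; exact: lt_irr dc.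
split=> // td; case: tc; exact: lt_tr td dc.
Qed.

Lemma Def_altn k (Q : (nat -> K) -> K -> Prop) i :
  Def (fun e => Q (fun i => e i.+1) (e 0)) -> Def (fun e => altn k (Q e) (e i)).
Proof.
elim: k Q i => [|k IH] Q i DQ /=; first exact: Def_true.
apply: Def_exists => //; apply: Def_and => //; first exact: Def_lt.
apply: Def_and => //.
  apply: Def_not => //; apply: Def_iffP => //.
  by apply: (Def_ren KD (fun l => if l is l'.+1 then l'.+1 else i.+1) DQ).
apply: (IH (fun e z => Q (fun i => e i.+1) z)).
by apply: (Def_ren KD (fun l => if l is l'.+1 then l'.+2 else 0) DQ).
Qed.

Lemma alternation_bound (P : (nat -> K) -> Prop) : Def P ->
  exists N, forall e t, ~ altn N (fun y => P (push y e)) t.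
Proof.
move=> DP; have [N HN] := uniform_finiteness HK DP.
exists N.*2 => e t /altn_at_least_bd M; apply: (HN e).
apply: (@at_least_sub _ _ (fun c => boundary (fun y => P (push y e)) c /\ ~ lt t c)).
  by move=> c [].
by apply: M; exact: Def_push_env.
Qed.

Definition traces (P : (nat -> K) -> Prop) d n (a : 'I_n -> nat -> K) : {set {set 'I_n}} :=
  [set T : {set 'I_n} | `[< exists g,
     T = [set k : 'I_n | `[< P (prepend d g (a k)) >]]%SET >]]%SET.

(** Two objects, packed into one environment. *)
Definition interleave (a b : nat -> K) : nat -> K :=
  fun i => if odd i then b i./2 else a i./2.

(** The environment consists of d parameters g and of the objects a k and a j,
   interleaved. Let S_k be the set of t such that P holds at t, g, a k. The points
   with at least i alternations of S_j before them form a final segment; the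
   predicate says that S_k contains an initial part of it. *)
Definition first_value (P : (nat -> K) -> Prop) d i (e : nat -> K) : Prop :=
  exists t, altn i (fun y => P (push y (prepend d e (fun l => e (d + l.*2.+1))))) t /\
    forall s, altn i (fun y => P (push y (prepend d e (fun l => e (d + l.*2.+1))))) s ->
      ~ lt t s -> P (push s (prepend d e (fun l => e (d + l.*2)))).

Lemma Def_first_value P d i : Def P -> Def (first_value P d i).
Proof.
move=> DP.
have D (h : nat -> nat) k : Def (fun e : nat -> K =>
    P (push (e 0) (prepend d (fun i => e (k + i).+1) (fun l => e (k + h l).+1)))).
  apply: (Def_iff _ (Def_ren KD (fun l => if l is l'.+1 then
    if l' < d then (k + l').+1 else (k + h (l' - d)).+1 else 0) DP)) => e.
  apply: eq_iff; congr P; apply: funext => -[//|l].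
  by rewrite /= /prepend; case: (l < d).
apply: Def_exists => //; apply: Def_and => //.
  exact: (Def_altn i (Q := fun e y => P (push y (prepend d (fun i => e i.+1)
    (fun l => e (d + l.*2.+1).+1)))) 0 (D (fun l => d + l.*2.+1) 1)).
apply: Def_forall => //; apply: Def_imp => //.
  exact: (Def_altn i (Q := fun e y => P (push y (prepend d (fun i => e i.+2)
    (fun l => e (d + l.*2.+1).+2)))) 0 (D (fun l => d + l.*2.+1) 2)).
apply: Def_imp => //; first by apply: Def_not => //; exact: Def_lt.
exact: (D (fun l => d + l.*2) 1).
Qed.

Lemma least_upset n (V : 'I_n -> K -> Prop) : 0 < n ->
  (forall k x y, V k x -> lt x y -> V k y) ->
  exists j, forall k x, V j x -> V k x.
Proof.
case: n V => // n V _ Vup.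
have tot j k : (forall x, V j x -> V k x) \/ (forall x, V k x -> V j x).
  have [|H] := pselect (forall x, V j x -> V k x); first by left.
  right=> x Vk; apply: contrapT => nVj; apply: H => y Vj.
  have [xy|[<-//|yx]] := lt_tricho KO x y; first exact: Vup xy.
  by case: nVj; exact: Vup yx.
have H (s : seq 'I_n.+1) : exists j, forall k, k \in s -> forall x, V j x -> V k x.
  elim: s => [|k s [j IH]]; first by exists ord0.
  have [jk|kj] := tot j k.
    by exists j => l; rewrite inE => /orP[/eqP->|/IH].
  exists k => l; rewrite inE => /orP[/eqP->//|/IH lP] x Vk.
  by apply: lP; exact: kj.
have [j Hj] := H (enum 'I_n.+1); exists j => k; apply: Hj.
by rewrite mem_enum.
Qed.

(** Let t be the first parameter, let i_k be the number of alternations of S_k up to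
   t, and V_k the final segment of the points with at least i_k alternations of
   S_k. The final segments are nested; let V_j be the smallest. For s in V_j with
   s <= t, no S_k has a further alternation between s and t, so S_k agrees at s
   and t. Hence t is in S_k if and only if S_k contains an initial part of V_j. *)
Lemma traces_step P d N n (a : 'I_n -> nat -> K) : 0 < n ->
  (forall e t, ~ altn N (fun y => P (push y e)) t) ->
  traces P d.+1 a \subset (\bigcup_(i < N) \bigcup_(j < n)
    traces (first_value P d i) d (fun k => interleave (a k) (a j)))%SET.
Proof.
move=> n0 HN; apply/fintype.subsetP => T; rewrite inE => /asboolP[g ->].
pose t := g 0; pose g' i := g i.+1.
pose S k y := P (push y (prepend d g' (a k))).
have idx k : exists i, i < N /\ altn i (S k) t /\ ~ altn i.+1 (S k) t.
  have : ~ altn N (S k) t by exact: HN.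
  elim: {HN} N => [|m IH]; first by case.
  have [mt Sm|/IH[i [im Hi]] _] := pselect (altn m (S k) t); first by exists m.
  by exists i; split=> //; exact: ltnW.
pose ix k := sval (cid (idx k)).
have ixP k : ix k < N /\ altn (ix k) (S k) t /\ ~ altn (ix k).+1 (S k) t.
  exact: (svalP (cid (idx k))).
have [|j Hj] := least_upset (V := fun k => altn (ix k) (S k)) n0.
  by move=> k x y Vx xy; exact: altn_up Vx.
have same k s : altn (ix j) (S j) s -> ~ lt t s -> S k s <-> S k t.
  move=> Vs ts; have [_ [_ nk]] := ixP k; apply: contrapT => NE; apply: nk.
  have [st|[sE|//]] := lt_tricho KO s t; last by subst s; case: NE.
  by exists s; split=> //; split=> //; exact: Hj.
have [ijN [jt _]] := ixP j.
apply/bigcupP; exists (Ordinal ijN) => //; apply/bigcupP; exists j => //.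
rewrite inE; apply/asboolP; exists g'; apply/setP => k; rewrite !inE.
apply: asbool_equiv_eq.
have -> : P (prepend d.+1 g (a k)) = S k t.
  by rewrite /S push_prepend; congr P; congr (prepend _ _ _); apply: funext => -[].
set e := prepend d g' (interleave (a k) (a j)).
have ek : prepend d e (fun l => e (d + l.*2)) = prepend d g' (a k).
  apply: funext => i; rewrite /e /prepend; case: ltnP => // di.
  by rewrite ltnNge leq_addr /= addKn /interleave odd_double doubleK.
have ej : prepend d e (fun l => e (d + l.*2.+1)) = prepend d g' (a j).
  apply: funext => i; rewrite /e /prepend; case: ltnP => // di.
  by rewrite ltnNge leq_addr /= addKn /interleave /= odd_double /= uphalf_double.
rewrite /first_value /= ek ej; split=> [St|[t' [Vt' Ht']]].
  by exists t; split=> // s Vs ts; apply/(same k s).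
have [tt'|tt'] := pselect (lt t t').
  apply: Ht' => //; move=> t't; exact: lt_irr (lt_tr KO tt' t't).
by apply/(same k t') => //; apply: Ht' => //; exact: lt_irr.
Qed.

Lemma leq_card_bigcup (I T : finType) (F : I -> {set T}) B :
  (forall i, #|F i| <= B) -> #|(\bigcup_i F i)%SET| <= #|I| * B.
Proof.
move=> FB; apply: (@leq_trans (\sum_i #|F i|)).
  elim/big_rec2: _ => [|i m A _ IH]; first by rewrite cards0.
  by rewrite (leq_trans (leq_card_setU _ _)) // leq_add2l.
by rewrite -sum_nat_const; apply: leq_sum.
Qed.

(** Induction on d: by traces_step, the traces for d + 1 parameters are traces for
   d parameters of one of the N * n families first_value, where N bounds the
   numbers of alternations. *)
Theorem card_traces P d : Def P -> exists C, forall n (a : 'I_n -> nat -> K),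
  0 < n -> #|traces P d a| <= C * n ^ d.
Proof.
elim: d P => [|d IH] P DP.
  exists 1 => n a n0; rewrite expn0 muln1.
  rewrite (leq_trans _ (eq_leq (cards1 [set k : 'I_n | `[< P (a k) >]]%SET))) //.
  apply/subset_leq_card/fintype.subsetP => T; rewrite [T \in traces _ _ _]inE => /asboolP[g ->].
  rewrite inE; apply/eqP/setP => k; rewrite !inE; congr (asbool (P _)).
  by apply: funext => i; rewrite /prepend subn0.
have [N HN] := alternation_bound DP.
have [C HC] : exists C, forall i, i < N -> forall n (a : 'I_n -> nat -> K),
    0 < n -> #|traces (first_value P d i) d a| <= C * n ^ d.
  elim: N {HN} => [|N [C HC]]; first by exists 0.
  have [C' HC'] := IH _ (Def_first_value d N DP).
  exists (maxn C C') => i; rewrite ltnS leq_eqVlt => /orP[/eqP->|iN] n a n0.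
    by rewrite (leq_trans (HC' n a n0)) // leq_mul2r leq_maxr orbT.
  by rewrite (leq_trans (HC i iN n a n0)) // leq_mul2r leq_maxl orbT.
exists (N * C) => n a n0.
rewrite (leq_trans (subset_leq_card (traces_step d a n0 HN))) //.
have -> : N * C * n ^ d.+1 = #|'I_N| * (#|'I_n| * (C * n ^ d)).
  by rewrite !card_ord expnS; lia.
apply: leq_card_bigcup => i; apply: leq_card_bigcup => j.
exact: HC.
Qed.

End Alternations.

Local Open Scope ring_scope.

(** * Renaming the variables of a formula *)

Section Renaming.
Variable L : language.

Fixpoint ren_term n m (s : 'I_n -> 'I_m) (t : term L n) : term L m :=
  match t with
  | Var i => Var L (s i)
  | App k g ts => App g (fun i => ren_term s (ts i))
  end.

Definition lift_ren n m (s : 'I_n -> 'I_m) (i : 'I_n.+1) : 'I_m.+1 :=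
  if unlift ord0 i is Some j then lift ord0 (s j) else ord0.

Fixpoint ren_formula n (phi : formula L n) : forall m, ('I_n -> 'I_m) -> formula L m :=
  match phi in formula _ n return forall m, ('I_n -> 'I_m) -> formula L m with
  | Equal _ t u => fun m s => Equal (ren_term s t) (ren_term s u)
  | Rel _ _ r ts => fun m s => Rel r (fun i => ren_term s (ts i))
  | Not _ p => fun m s => Not (ren_formula p s)
  | And _ p q => fun m s => And (ren_formula p s) (ren_formula q s)
  | Or _ p q => fun m s => Or (ren_formula p s) (ren_formula q s)
  | Imp _ p q => fun m s => Imp (ren_formula p s) (ren_formula q s)
  | Forall _ p => fun m s => Forall (ren_formula p (lift_ren s))
  | Exists _ p => fun m s => Exists (ren_formula p (lift_ren s))
  end.

Variables (T : Type) (M : structure L T).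

Lemma eval_ren n m (s : 'I_n -> 'I_m) (e : 'rV[T]_m) (t : term L n) :
  Defs.eval M e (ren_term s t) = Defs.eval M (\row_i e ord0 (s i)) t.
Proof.
elim: t => [i|k g ts IH] /=; first by rewrite mxE.
by congr (fun_interp _ _ _); apply/rowP => i; rewrite !mxE.
Qed.

Lemma row_lift_ren n m (s : 'I_n -> 'I_m) (e : 'rV[T]_m) u :
  \row_i (row_mx (const_mx u : 'rV_1) e) ord0 (lift_ren s i) =
  row_mx (const_mx u : 'rV_1) (\row_i e ord0 (s i)).
Proof.
apply/rowP => i; rewrite mxE /lift_ren.
case: unliftP => [j|] ->.
  have E k (j' : 'I_k) : lift ord0 j' = rshift 1 j' by apply: val_inj.
  rewrite !E; apply: (etrans (row_mxEr _ _ _ _)); apply: esym.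
  by apply: (etrans (row_mxEr _ _ _ _)); rewrite mxE.
have E k : ord0 = lshift k (ord0 : 'I_1) by apply: val_inj.
rewrite [X in row_mx _ _ _ X = _]E [X in _ = row_mx _ _ _ X]E.
apply: (etrans (row_mxEl _ _ _ _)); apply: esym.
by apply: (etrans (row_mxEl _ _ _ _)); rewrite !mxE.
Qed.

Lemma sat_ren_formula n (phi : formula L n) m (s : 'I_n -> 'I_m) (e : 'rV[T]_m) :
  sat M (ren_formula phi s) e <-> sat M phi (\row_i e ord0 (s i)).
Proof.
elim: phi m s e => {n} /=.
- by move=> n t u m s e; rewrite !eval_ren.
- move=> n k r ts m s e; apply: eq_iff; congr (rel_interp _ _ _).
  by apply/rowP => i; rewrite !mxE eval_ren.
- by move=> n p IH m s e; rewrite IH.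
- by move=> n p IHp q IHq m s e; rewrite IHp IHq.
- by move=> n p IHp q IHq m s e; rewrite IHp IHq.
- by move=> n p IHp q IHq m s e; rewrite IHp IHq.
- by move=> n p IH m s e; split=> H u; move: (H u); rewrite IH row_lift_ren.
- by move=> n p IH m s e; split=> -[u Hu]; exists u; move: Hu; rewrite IH row_lift_ren.
Qed.

End Renaming.

(** * The real structure *)

Section RealSystem.
Import numFieldNormedType.Exports.
Variables (R : realType) (L : ring_language) (M : structure L R).
Hypotheses (HM : expands_real_field M) (Homin : o_minimal M).

Definition value (e : nat -> R) (x : nat + R) : R :=
  match x with inl i => e i | inr c => c end.

(** Each variable of the formula is either read from the environment or a real
   parameter; the map s says which. *)
Definition real_def (P : (nat -> R) -> Prop) : Prop :=
  exists n (phi : formula L n) (s : 'I_n -> nat + R),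
    forall e, P e <-> sat M phi (\row_i value e (s i)).

Definition real_system : system := {|
  elt := R;
  lt x y := x < y;
  scale d := 0 < d;
  proximal d x y := `|x - y| < d;
  Def := real_def |}.

Local Notation K := real_system.

Lemma real_def_formula n (phi : formula L n) (P : (nat -> K) -> Prop) :
  (forall e, P e <-> sat M phi (\row_i e i)) -> Def P.
Proof.
move=> HP; exists n, phi, (fun i => inl (nat_of_ord i)) => e.
by rewrite HP; apply: eq_iff; congr (sat _ _ _); apply/rowP => i; rewrite !mxE.
Qed.

Definition args2 n (t u : term L n) (i : 'I_2) : term L n :=
  if i == ord0 then t else u.

Lemma sat_lt n (t u : term L n) (e : 'rV[R]_n) :
  sat M (Rel (lt_symb L) (args2 t u)) e <-> Defs.eval M e t < Defs.eval M e u.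
Proof. by have [_ _ _ _ Hlt] := HM; rewrite /= Hlt !mxE. Qed.

Lemma eval_add n (t u : term L n) (e : 'rV[R]_n) :
  Defs.eval M e (App (add_symb L) (args2 t u)) = Defs.eval M e t + Defs.eval M e u.
Proof. by have [Hadd _ _ _ _] := HM; rewrite /= Hadd !mxE. Qed.

Lemma sat_equal n (t u : term L n) (e : 'rV[R]_n) :
  sat M (Equal t u) e <-> Defs.eval M e t = Defs.eval M e u.
Proof. by []. Qed.

Lemma sat_and n (p q : formula L n) (e : 'rV[R]_n) :
  sat M (And p q) e <-> sat M p e /\ sat M q e.
Proof. by []. Qed.

Definition var n i (Hi : (i < n)%N) : term L n := Var L (Ordinal Hi).

Lemma real_def_lt : Def (fun e : nat -> K => lt (e 0%N) (e 1%N)).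
Proof.
apply: (@real_def_formula 2 (Rel (lt_symb L) (args2 (@var 2 0 isT) (@var 2 1 isT)))) => e.
by rewrite sat_lt /= !mxE.
Qed.

Definition plus (x y z : K) : Prop := x = y + z :> R.

Lemma real_def_plus : Def3 plus.
Proof.
apply: (@real_def_formula 3 (Equal (@var 3 0 isT)
   (App (add_symb L) (args2 (@var 3 1 isT) (@var 3 2 isT))))) => e.
by rewrite sat_equal eval_add /= !mxE.
Qed.

Lemma real_def_proximal : Def (fun e : nat -> K => proximal (e 0%N) (e 1%N) (e 2%N)).
Proof.
apply: (@real_def_formula 3 (And
  (Rel (lt_symb L) (args2 (@var 3 1 isT)
     (App (add_symb L) (args2 (@var 3 2 isT) (@var 3 0 isT)))))
  (Rel (lt_symb L) (args2 (@var 3 2 isT)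
     (App (add_symb L) (args2 (@var 3 1 isT) (@var 3 0 isT))))))) => e.
rewrite sat_and !sat_lt !eval_add /= !mxE /= ltr_norml.
by split=> [/andP[? ?]|[? ?]]; [split; lra | apply/andP; split; lra].
Qed.

Lemma real_and (P Q : (nat -> K) -> Prop) : Def P -> Def Q -> Def (fun e => P e /\ Q e).
Proof.
move=> [n [phi [s HP]]] [m [psi [t HQ]]].
exists (n + m)%N, (And (ren_formula phi (@lshift n m)) (ren_formula psi (@rshift n m))).
exists (fun i : 'I_(n + m) => match fintype.split i with inl j => s j | inr k => t k end) => e.
rewrite /= !sat_ren_formula HP HQ.
apply: eq_iff; congr (_ /\ _); congr (sat _ _ _); apply/rowP => i; rewrite !mxE.
  by rewrite (unsplitK (inl i)).
by rewrite (unsplitK (inr i)).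
Qed.

Lemma real_not (P : (nat -> K) -> Prop) : Def P -> Def (fun e => ~ P e).
Proof. by move=> [n [phi [s HP]]]; exists n, (Not phi), s => e; rewrite /= HP. Qed.

Lemma real_ren (P : (nat -> K) -> Prop) s : Def P -> Def (fun e => P (fun i => e (s i))).
Proof.
move=> [n [phi [t HP]]].
exists n, phi, (fun i => match t i with inl j => inl (s j) | inr c => inr c end) => e.
rewrite HP; apply: eq_iff; congr (sat _ _ _); apply/rowP => i; rewrite !mxE.
by case: (t i).
Qed.

(** All variables of phi that read entry 0 become the bound variable. *)
Lemma real_ex (P : (nat -> K) -> Prop) : Def P -> Def (fun e => exists y, P (push y e)).
Proof.
move=> [n [phi [s HP]]].
pose r (i : 'I_n) : 'I_(1 + n) := if s i is inl 0%N then lshift n ord0 else rshift 1 i.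
pose s' i : nat + R := match s i with inl j.+1 => inl j | inl 0%N => inr 0 | inr c => inr c end.
exists n, (Exists (ren_formula phi r)), s' => e.
have E u : P (push u e) <-> sat M (ren_formula phi r) (row_mx (const_mx u : 'rV_1)
   (\row_i value e (s' i))).
  rewrite sat_ren_formula HP; apply: eq_iff; congr (sat _ _ _); apply/rowP => i; rewrite [LHS]mxE [RHS]mxE /r.
  case si: (s i) => [[|j]|c]; first by rewrite row_mxEl mxE.
    by rewrite row_mxEr mxE /s' si.
  by rewrite row_mxEr mxE /s' si.
by split=> -[u Hu]; exists u; apply/E.
Qed.

Lemma real_const (c : K) : Def (fun e : nat -> K => e 0%N = c).
Proof.
exists 2, (Equal (@var 2 0 isT) (@var 2 1 isT)).
exists (fun i : 'I_2 => if i == ord0 then inl 0%N else inr c) => e.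
by rewrite sat_equal /= !mxE.
Qed.

Lemma real_definability : definability K.
Proof.
split; [exact: real_and|exact: real_not|exact: real_ex|exact: real_ren|exact: real_def_lt| | | |].
- apply: (@Def_iff K (fun e => exists y : K, (y = 0 :> R) /\ lt y (e 0%N))).
    by move=> e; split=> [[y [-> //]]|e0]; exists 0.
  apply: (real_ex (P := fun e => e 0%N = 0 :> R /\ lt (e 0%N) (e 1%N))).
  by apply: real_and; [exact: real_const | exact: real_def_lt].
- exact: real_def_proximal.
- exact: real_const.
- move=> P [n [phi [s HP]]].
  exists (\max_(i < n) (if s i is inl j then j.+1 else 0))%N => e e' ee'.
  rewrite !HP (_ : \row_i value e' (s i) = \row_i value e (s i)) //.
  apply/rowP => i; rewrite !mxE.
  case si: (s i) => [j|//] /=; apply/esym/ee'.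
  by apply: (leq_trans _ (leq_bigmax i)); rewrite si.
Qed.

Lemma real_order : uniform_order K.
Proof.
split=> /=.
- by move=> x; rewrite ltxx.
- by move=> x y z; exact: lt_trans.
- by move=> x y; have [|?|->] := ltgtP x y; auto.
- by move=> x y xy; exists ((x + y) / 2); split; lra.
- by move=> x; exists (x - 1); lra.
- by move=> x; exists (x + 1); lra.
- by exists 1; rewrite ltr01.
- by move=> d x d0; rewrite subrr normr0.
- by move=> d x y; rewrite distrC.
- by move=> d d' x y dd' xy; exact: lt_trans dd'.
- move=> d d0; exists (d / 2); split=> [|x y z xy zy]; first by lra.
  by move: xy zy; rewrite !ltr_norml => /andP[? ?] /andP[? ?]; apply/andP; split; lra.
- move=> a x b ax xb; exists (Num.min (x - a) (b - x)).
  rewrite lt_min !subr_gt0 ax xb; split=> // y.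
  by rewrite lt_min !ltr_norml => /andP[/andP[? ?] /andP[? ?]]; split; lra.
- move=> a b d ab d0; pose h := Num.min d (b - a) / 3.
  have [h0 hd hba] : [/\ 0 < h, 3 * h <= d & 3 * h <= b - a].
    rewrite /h; split; last 2 first.
    - by rewrite mulrC divfK // ge_min lexx.
    - by rewrite mulrC divfK // ge_min lexx orbT.
    by rewrite divr_gt0 // lt_min d0 subr_gt0.
  exists (a + h), (a + h + h); split; first by lra.
  split; first by lra.
  split; first by lra.
  by move=> x y ? ? ? ?; rewrite ltr_norml; apply/andP; split; lra.
Qed.

(** * One-variable definable sets *)

Lemma real_Def1 (S : K -> Prop) : Def1 S -> definable M S.
Proof.
move=> [n [phi [s HS]]].
pose r (i : 'I_n) : 'I_(1 + n) := if s i is inl 0%N then lshift n ord0 else rshift 1 i.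
exists n, (ren_formula phi r), (\row_i value (fun=> 0) (s i)).
apply/seteqP; split=> y; rewrite /= sat_ren_formula => Sy.
  have /HS := Sy : S (push y (fun=> 0) 0%N).
  congr (sat _ _ _); apply/rowP => i; rewrite [LHS]mxE [RHS]mxE /r.
  case si: (s i) => [[|j]|c]; first by rewrite row_mxEl mxE.
    by rewrite row_mxEr mxE si.
  by rewrite row_mxEr mxE si.
rewrite -[S y]/(S (push y (fun=> 0) 0%N)); apply/HS; move: Sy.
congr (sat _ _ _); apply/rowP => i; rewrite [LHS]mxE [RHS]mxE /r.
case si: (s i) => [[|j]|c]; first by rewrite row_mxEl mxE.
  by rewrite row_mxEr mxE si.
by rewrite row_mxEr mxE si.
Qed.

Definition decided (F : set_system R) (S : set R) := F S \/ F (~` S).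

Definition cut (F : set_system R) (r : R) :=
  F [set x | x < r] \/ F [set x | r < x].

Lemma decided_interval_or_point (S : set R) : open_interval_or_point S ->
  exists l : seq R, forall F, Filter F -> {in l, forall r, cut F r} -> decided F S.
Proof.
move=> [[a [b ->]]|[r ->]]; last first.
  exists [:: r] => F FF /(_ r (mem_head _ _))[] Fr; right;
    by apply: filterS Fr => x /= + xr; rewrite xr ltxx.
exists [:: fine a; fine b] => F FF cF.
have [ca cb] : cut F (fine a) /\ cut F (fine b).
  by split; apply: cF; rewrite !inE eqxx ?orbT.
have [Fa|Fa] : decided F [set x | (a < x%:E)%E].
  case: a ca {cF} => [r|_|_] /=.
  - case=> H; [right|left]; apply: filterS H => x /=; rewrite lte_fin //.
    by move=> /ltW; rewrite leNgt => /negP.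
  - by right; apply: filterS (filterT (F := F)) => x _ /=; rewrite ltNge leey.
  - by left; apply: filterS (filterT (F := F)) => x _ /=; rewrite ltNyr.
- have [Fb|Fb] : decided F [set x | (x%:E < b)%E].
    case: b cb {cF} => [r|_|_] /=.
    + case=> H; [left|right]; apply: filterS H => x /=; rewrite lte_fin //.
      by move=> /ltW; rewrite leNgt => /negP.
    + by left; apply: filterS (filterT (F := F)) => x _ /=; rewrite ltry.
    + by right; apply: filterS (filterT (F := F)) => x _ /=; rewrite ltNge leNye.
  + by left; apply: filterS (filterI Fa Fb) => x [/= -> ->].
  + by right; apply: filterS Fb => x /= xb /andP[].
- by right; apply: filterS Fa => x /= xa /andP[].
Qed.

(** The list consists of the endpoints in a decomposition of S. *)
Lemma decided_definable (S : K -> Prop) : Def1 S ->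
  exists l : seq R, forall F, Filter F -> {in l, forall r, cut F r} -> decided F S.
Proof.
move=> /real_Def1/Homin[k [T [HT ->]]].
have [l Hl] := choice (fun i => decided_interval_or_point (HT i)).
exists (flatten [seq l i | i <- enum 'I_k]) => F FF cF.
have dT i : decided F (T i).
  apply: Hl => r rl; apply: cF; apply/flatten_mapP; exists i => //.
  by rewrite mem_enum.
have [[i FTi]|H] := pselect (exists i, F (T i)).
  by left; apply: filterS FTi => x Tx; exists i.
right; have : F [set x | forall i, ~ T i x].
  by apply: filter_forall => i; have [FT|//] := dT i; case: H; exists i.
by apply: filterS => x nT [i _ /nT].
Qed.

Lemma nbhs_interval (c : R) (S : set R) : nbhs c S ->
  exists2 e, 0 < e & forall x, c - e < x -> x < c + e -> S x.
Proof.
move=> /nbhs_ballP[e /= e0 eS]; exists e => // x x1 x2; apply: eS.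
by rewrite /ball /= ltr_norml; apply/andP; split; lra.
Qed.

Lemma interval_nbhs (a b c : R) : a < c -> c < b -> nbhs c [set x | a < x /\ x < b].
Proof.
move=> ac cb; apply/nbhs_ballP; exists (Num.min (c - a) (b - c)) => /=.
  by rewrite lt_min !subr_gt0 ac.
move=> x; rewrite /ball /= lt_min !ltr_norml => /andP[/andP[? ?] /andP[? ?]].
by split; lra.
Qed.

Lemma at_least_seq (T : eqType) (l : seq T) (S : T -> Prop) :
  (forall y, S y -> y \in l) -> ~ at_least (size l).+1 S.
Proof.
have [n] := ubnP (size l); elim: n l S => // n IH l S; rewrite ltnS => ln Sl.
move=> [y [/[dup] Sy /Sl yl]].
have sl : size (rem y l) = (size l).-1 by rewrite size_rem.
have l0 : (0 < size l)%N by case: (l) yl.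
rewrite -(prednK l0) -sl; apply: IH.
  by rewrite sl prednK.
move=> z [/Sl zl /eqP zy].
have : z \in y :: rem y l by rewrite -(perm_mem (perm_to_rem yl)).
by rewrite inE (negPf zy).
Qed.

Lemma real_omin : o_minimal_system K.
Proof.
split=> P e DP; have DS := Def_push_env real_definability real_order e DP.
- have [l Hl] := decided_definable DS.
  exists (size l).+1; apply: at_least_seq => c bc; apply: contrapT => cl.
  have : decided (nbhs c) (fun y => P (push y e)).
    apply: Hl => r rl; have [cr|rc|rc] := ltgtP c r.
    - have c1 : c - 1 < c by lra.
      by left; apply: filterS (interval_nbhs c1 cr) => x [].
    - have c1 : c < c + 1 by lra.
      by right; apply: filterS (interval_nbhs rc c1) => x [].
    - by subst r.
  case=> /nbhs_interval[d d0 dS].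
    have [||y [_ [z [[z1 z2] [_ []]]]]] := bc (c - d) (c + d); rewrite /=; try lra.
    exact: dS.
  have [||y [[y1 y2] [z [_ [Py _]]]]] := bc (c - d) (c + d); rewrite /=; try lra.
  exact: (dS y).
- move=> [y Py] [b Hb]; pose S : set R := fun y => P (push y e).
  have S0 : S !=set0 by exists y.
  have Sb : has_ubound S by exists b => z /Hb /negP; rewrite -leNgt.
  exists (sup S); split=> [z Pz|b' Hb'].
    by apply/negP; rewrite -leNgt; exact: ub_le_sup.
  apply/negP; rewrite -leNgt; apply: ge_sup => // z /Hb' /negP.
  by rewrite -leNgt.
Qed.

Lemma real_o_minimal_structure : o_minimal_structure K.
Proof. by split; [exact: real_definability|exact: real_order|exact: real_omin]. Qed.

End RealSystem.

(** * Definable choice in the reals *)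

Section RealChoice.
Variables (R : realType) (L : ring_language) (M : structure L R).
Hypotheses (HM : expands_real_field M) (Homin : o_minimal M).

Local Notation K := (real_system M).

Let KS := real_o_minimal_structure HM Homin.
Let KD := real_definability HM.
Let KO := real_order M.

Definition lower (S : K -> Prop) (b : K) : Prop := forall z, S z -> ~ lt z b.
Definition upper (S : K -> Prop) (b : K) : Prop := forall z, S z -> ~ lt b z.

(* The bound a + one keeps the supremum of the stretch finite. *)
Definition stretch (one a : K) (S : K -> Prop) (t : K) : Prop :=
  lt a t /\ (exists w, plus w a one /\ ~ lt w t) /\
  forall s, lt a s -> lt s t -> S s.

(** A point of S determined by S: the least nonnegative one, or, if the infimum a of
   the nonnegative ones is not attained, the midpoint of the stretch of S that
   begins at a. *)
Definition canonical_point (zero one : K) (S : K -> Prop) (y : K) : Prop :=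
  let N z := ~ lt z zero /\ S z in
  (N y /\ lower N y) \/
  (~ (exists m, N m /\ lower N m)) /\
  exists a, (lower N a /\ (forall b, lower N b -> ~ lt a b)) /\
  exists c, (upper (stretch one a S) c /\
             forall b, upper (stretch one a S) b -> ~ lt b c) /\
  exists w, plus w a c /\ plus w y y.

Lemma Def_canonical_point zero one (P : (nat -> K) -> Prop) : Def P ->
  Def (fun e => canonical_point zero one (fun z => P (push z (fun i => e i.+1))) (e 0%N)).
Proof.
move=> DP; have Dplus : Def3 (@plus _ _ M) by exact: real_def_plus.
rewrite /canonical_point /lower /upper /stretch; def_tac.
Qed.

Lemma nltP (x y : K) : ~ lt x y <-> (y <= x :> R).
Proof. by rewrite /= leNgt; split=> /negP. Qed.

Lemma canonical_point_uniq zero one S y z :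
  canonical_point zero one S y -> canonical_point zero one S z -> y = z.
Proof.
have anti (u v : K) : ~ lt u v -> ~ lt v u -> u = v.
  by move=> /nltP uv /nltP vu; apply/eqP; rewrite eq_le vu uv.
move=> [[Ny ly]|[nm [a [[la ga] [c [[uc gc] [w [wac wyy]]]]]]]].
  move=> [[Nz lz]|[nm _]]; last by case: nm; exists y.
  by apply: anti; [exact: lz | exact: ly].
move=> [[Nz lz]|[_ [a' [[la' ga'] [c' [[uc' gc'] [w' [wac' wzz]]]]]]]].
  by case: nm; exists z.
have aa : a = a' by apply: anti; [exact: ga | exact: ga'].
subst a'; have cc : c = c' by apply: anti; [exact: gc' | exact: gc].
by subst c'; move: wac wyy wac' wzz; rewrite /plus /=; lra.
Qed.

Section CanonicalPoint.
Variables (zero one : K) (S : K -> Prop).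
Hypotheses (DS : Def1 S) (one_gt0 : 0 < (one : R)).

Let N z := ~ lt z zero /\ S z.

(* The points of S accumulate at a from above, and the germ of S there is
   constant. *)
Let stretch_ex a : (exists z, N z) -> ~ (exists m, N m /\ lower N m) ->
  lower N a -> (forall b, lower N b -> ~ lt a b) -> exists t, stretch one a S t.
Proof.
move=> [z0 Nz0] nm la ga.
have [_ [b [_ ab _ Sab]]] := const_germs KS a DS.
have Na : ~ N a by move=> Na; apply: nm; exists a.
have [z [Nz zb]] : exists z, N z /\ lt z b.
  apply: contrapT => H; case: (ga b) => // z Nz zb; apply: H; by exists z.
have az : lt a z.
  by have [//|[az|za]] := lt_tricho KO a z; [subst z | case: (la z)].
have {}Sab y : lt a y -> lt y b -> S y.
  case: Sab => Sab; first exact: Sab.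
  by case: (Sab z az zb); case: Nz.
exists (Num.min b (a + one)); split.
  by rewrite /= lt_min ab /= ltrDl.
split; first by exists (a + one); split=> //; apply/nltP; rewrite ge_min lexx orbT.
by move=> s as_; rewrite /= lt_min => /andP[sb _]; exact: Sab.
Qed.

Lemma canonical_point_sub y : (exists z, N z) -> canonical_point zero one S y -> S y.
Proof.
move=> Nex [[[_ Sy] _]//|[nm [a [[la ga] [c [[uc gc] [w [wac wyy]]]]]]]].
have [t st] := stretch_ex Nex nm la ga.
have ac : a < c :> R.
  by have /nltP := uc t st; have [at_ _] := st; exact: lt_le_trans.
have yc : y < c :> R by move: wac wyy; rewrite /plus /=; lra.
have [u [[_ [_ uS]] yu]] : exists u, stretch one a S u /\ lt y u.
  apply: contrapT => H; apply: (gc y) => // u su yu; apply: H; by exists u.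
by apply: uS => //; move: wac wyy; rewrite /plus /=; lra.
Qed.

Lemma canonical_point_ex : (exists z, N z) -> exists y, canonical_point zero one S y.
Proof.
move=> Nex; have [[m Hm]|nm] := pselect (exists m, N m /\ lower N m).
  by exists m; left.
have N0 : [set z | N z] !=set0 by case: Nex => z Nz; exists z.
have Nlb : has_lbound [set z | N z] by exists zero => z [/nltP].
pose a : K := inf [set z | N z].
have la : lower N a by move=> z Nz; apply/nltP; exact: ge_inf.
have ga b : lower N b -> ~ lt a b.
  by move=> lb; apply/nltP; apply: lb_le_inf => // z Nz; apply/nltP; exact: lb.
have [t st] := stretch_ex Nex nm la ga.
pose c : K := sup [set t | stretch one a S t].
have Tub : has_ubound [set t | stretch one a S t].
  by exists (a + one) => u [_ [[w [-> /nltP]]]].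
exists ((a + c) / 2); right; split=> //; exists a; split=> //; exists c; split.
  split=> [u su|b ub]; apply/nltP; first exact: ub_le_sup.
  apply: ge_sup; first by exists t.
  by move=> u su; apply/nltP; exact: ub.
by exists (a + c : R); split; rewrite /plus //=; lra.
Qed.

End CanonicalPoint.

Lemma choice_nonneg (P : (nat -> K) -> Prop) : Def P ->
  exists Q : (nat -> K) -> Prop,
    [/\ Def Q, forall e, Q e -> P e,
        forall e y, P (push y e) -> 0 <= (y : R) -> exists z, Q (push z e)
      & forall e y z, Q (push y e) -> Q (push z e) -> y = z].
Proof.
move=> DP; pose S e : K -> Prop := fun z => P (push z e).
have DS e : Def1 (S e) by exact: (Def_push_env KD KO e DP).
exists (fun e => (exists z, ~ lt z (0 : K) /\ S (fun i => e i.+1) z) /\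
  canonical_point 0 1 (S (fun i => e i.+1)) (e 0%N)); split.
- apply: Def_and => //; last exact: Def_canonical_point.
  have Dz : Def1 (fun z : K => ~ lt z (0 : K)).
    apply: Def_not => //.
    exact: (Def_param KD (F := fun c e => lt (e 0%N) c) (0 : K) (Def_lt KD 1 0)).
  rewrite /S; def_tac.
- move=> e [Nex pe]; rewrite -(push_eta e).
  exact: (canonical_point_sub (DS _) ltr01 Nex pe).
- move=> e y Py y0.
  have Nex : exists z, ~ lt z (0 : K) /\ S e z by exists y; split=> //; apply/nltP.
  have [z pz] := canonical_point_ex (DS e) ltr01 Nex.
  by exists z.
- by move=> e y z [_ py] [_ pz]; exact: canonical_point_uniq py pz.
Qed.

(** A set without nonnegative points is reflected at 0. *)
Lemma real_choice : uniformizable K.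
Proof.
move=> P DP; have [Q [DQ QP Qex Quniq]] := choice_nonneg DP.
have Dplus : Def3 (@plus _ _ M) by exact: real_def_plus.
have D0 : Def1 (fun z : K => z = (0 : K)) by exact: real_const.
pose P' (e : nat -> K) := exists z,
  (exists w, (fun z => z = (0 : K)) w /\ plus w z (e 0%N)) /\
  P (push z (fun i => e i.+1)).
have DP' : Def P' by rewrite /P'; def_tac.
have [Q' [DQ' QP' Qex' Quniq']] := choice_nonneg DP'.
exists (fun e => Q e \/ (~ exists z, Q (push z (fun i => e i.+1))) /\
  exists z, (exists w, (fun z => z = (0 : K)) w /\ plus w z (e 0%N)) /\
    Q' (push z (fun i => e i.+1))); split.
- by def_tac.
- move=> e [/QP//|[_ [z [[w [-> wz]] /QP'[y [[w' [-> wy]] Py]]]]]].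
  rewrite -(push_eta e) (_ : e 0%N = y) //.
  by move: wz wy; rewrite /plus /=; lra.
- move=> e y Py; have [[z Qz]|nQ] := pselect (exists z, Q (push z e)).
    by exists z; left.
  have y0 : y < 0 :> R.
    by rewrite ltNge; apply/negP => y0; apply: nQ; exact: Qex Py y0.
  have [||z Qz] := Qex' e (- (y : R)).
  + exists y; split=> //; exists 0; split=> //; rewrite /plus /=; lra.
  + lra.
  exists (- (z : R)); right; split=> //; exists z; split=> //.
  exists 0; split=> //; rewrite /plus /=; lra.
- move=> e y z [Qy|[nQ [y' [[w [-> wy]] Qy']]]] [Qz|[nQ' [z' [[w' [-> wz]] Qz']]]].
  + exact: Quniq Qy Qz.
  + by case: nQ'; exists y.
  + by case: nQ; exists z.
  have yz := Quniq' _ _ _ Qy' Qz'.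
  by subst z'; move: wy wz; rewrite /plus /=; lra.
Qed.

Theorem real_tame : tame K.
Proof. by split; [exact: KS | exact: real_choice]. Qed.

End RealChoice.

(** * Subgraphs *)

Definition env_of (R : realType) n (v : 'rV[R]_n) : nat -> R :=
  fun i => if insub i is Some j then v ord0 j else 0.

Lemma env_ofE (R : realType) n (v : 'rV[R]_n) (i : 'I_n) : env_of v i = v ord0 i.
Proof. by rewrite /env_of valK. Qed.

Section Subgraphs.
Variables (R : realType) (L : ring_language) (M : structure L R).
Hypotheses (HM : expands_real_field M).
Variables (m d : nat) (phi : formula L (1 + m + d)) (f : 'rV[R]_d -> 'rV[R]_m -> R).
Hypothesis Hf : forall (b : 'rV[R]_d) (x : 'rV[R]_m) (y : R),
  f b x = y <-> sat M phi (row_mx (row_mx (const_mx y : 'rV[R]_1) x) b).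

Local Notation K := (real_system M).

(** The environment consists of b, x and the height t, which has index d + m. *)
Definition in_subgraph (e : nat -> K) : Prop :=
  exists y : K,
    sat M phi (row_mx (row_mx (const_mx y : 'rV[R]_1) (\row_(i < m) e (d + i)%N))
                      (\row_(j < d) e j)) /\
    exists z : K, z = (0 : K) /\
      ((~ lt (e (d + m)%N) z /\ ~ lt y (e (d + m)%N)) \/
       (lt y (e (d + m)%N) /\ lt (e (d + m)%N) z)).

Lemma Def_in_subgraph : Def in_subgraph.
Proof.
have KD := real_definability HM.
have D0 : Def1 (fun z : K => z = (0 : K)) by exact: real_const.
rewrite /in_subgraph; apply: Def_exists => //; apply: Def_and => //; last by def_tac.
exists (1 + m + d)%N, phi, (fun i => inl (match fintype.split i with
  | inl k => match fintype.split k with inl _ => 0 | inr i => (d + i).+1 end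
  | inr j => j.+1 end)%N) => e.
apply: eq_iff; congr (sat _ _ _); apply/rowP => i; rewrite !mxE.
case: (fintype.split i) => [k|j]; last by rewrite mxE.
by rewrite mxE; case: (fintype.split k) => l; rewrite mxE.
Qed.

Lemma subgraphP (b : 'rV[R]_d) (v : 'rV[R]_(m + 1)) :
  subgraph (f b) v <-> in_subgraph (prepend d (env_of b) (env_of v)).
Proof.
set e := prepend d _ _.
have eb : \row_(j < d) e j = b.
  by apply/rowP => j; rewrite mxE /e /prepend ltn_ord env_ofE.
have ex : \row_(i < m) e (d + i)%N = lsubmx v.
  apply/rowP => i; rewrite !mxE /e /prepend ltnNge leq_addr /= addKn.
  exact: (env_ofE v (lshift 1 i)).
have et : e (d + m)%N = rsubmx v ord0 ord0.
  rewrite mxE /e /prepend ltnNge leq_addr /= addKn.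
  by have := env_ofE v (rshift m (ord0 : 'I_1)); rewrite /= addn0.
rewrite /in_subgraph ex eb et /subgraph /=; split=> [H|[y [/Hf <- [_ [-> H]]]]].
  exists (f b (lsubmx v)); split; first exact/Hf.
  exists 0; split=> //; case: H => /andP[H1 H2]; [left|by right].
  by split; apply/negP; rewrite -leNgt.
case: H => -[H1 H2]; [left|right]; last by rewrite H1.
by rewrite !leNgt; apply/andP; split; exact/negP.
Qed.

(** A trace on G is the image of the set of indices of its points, and these index
   sets are among the traces counted before. *)
Lemma card_subgraph_trace (G : {fset 'rV[R]_(m + 1)}) :
  (#|` fset_set (trace G [set subgraph (f b) | b in [set: 'rV[R]_d]])| <=
   #|@traces K in_subgraph d #|`G| (fun k => env_of (nth 0%R G k))|)%N.
Proof.
set n := #|`G|.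
pose h (T : {set 'I_n}) : set 'rV[R]_(m + 1) := [set x | exists2 k, k \in T & x = nth 0%R G k].
rewrite cardE -(size_map h); apply: uniq_leq_size; first exact: fset_uniq.
move=> X; rewrite in_fset_set; last exact: finite_trace.
rewrite inE => -[_ [b _ <-] <-]; apply/mapP.
exists [set k : 'I_n | `[< in_subgraph (prepend d (env_of b) (env_of (nth 0%R G k))) >]]%SET.
  by rewrite mem_enum inE; apply/asboolP; exists (env_of b).
apply/seteqP; split=> [x [xG xb]|x [k]].
  have xn : (index x G < n)%N by rewrite index_mem.
  exists (Ordinal xn); last by rewrite /= nth_index.
  by rewrite inE; apply/asboolP; rewrite /= nth_index //; exact/subgraphP.
rewrite inE => /asboolP/subgraphP bx ->; split=> //=.
by apply: mem_nth.
Qed.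

End Subgraphs.

Theorem corollary1 (R : realType) (L : ring_language) (M : structure L R)
    (HM : expands_real_field M) (Homin : o_minimal M)
    (m d : nat) (m_gt0 : (0 < m)%N) (d_gt0 : (0 < d)%N)
    (phi : formula L (1 + m + d))
    (f : 'rV[R]_d -> 'rV[R]_m -> R)
    (Hf : forall (b : 'rV[R]_d) (x : 'rV[R]_m) (y : R),
        f b x = y <->
        sat M phi (row_mx (row_mx (const_mx y : 'rV[R]_1) x) b)) :
  (vc_density R [set subgraph (f b) | b in [set: 'rV[R]_d]] <= d%:R%:E)%E.
Proof.
have [C HC] := card_traces (real_tame HM Homin) d (Def_in_subgraph HM phi).
apply: ge_ereal_inf; exists d%:R%:E => //; exists d%:R => //.
split; first by rewrite ltr0n.
exists C.+1%:R; split; first by rewrite ltr0n.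
move=> n n0; apply: ge_ereal_sup => _ [G Gn <-].
rewrite lee_fin powR_mulrn // -natrX -natrM ler_nat.
apply: leq_trans (card_subgraph_trace Hf G) _; rewrite Gn.
by rewrite (leq_trans (HC _ _ n0)) // leq_mul2r leqnSn orbT.
Qed.
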